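(* Let $n\ge1$, $m\in\{1,\dots,n\}$ and let $E \subset \mathbb{R}^n$ be a non-empty bounded set. (a) Suppose that the function $\theta\mapsto\underline{\dim}_{\,\theta} E$ on $[0,1]$ is continuous at $\theta=0$. Then $\underline{\dim}_{\mathrm{B}}\, \pi_V E = m$ for $\gamma_{n, m}$-almost all $V \in G(n, m)$ if and only if $\dim_{\mathrm{H}} E \geq m$. (b) Suppose that the function $\theta\mapsto\overline{\dim}_{\,\theta} E$ on $[0,1]$ is continuous at $\theta=0$. Then $\overline{\dim}_{\mathrm{B}}\, \pi_V E = m$ for $\gamma_{n, m}$-almost all $V \in G(n, m)$ if and only if $\dim_{\mathrm{H}} E \geq m$.
   Context: $\dim_{\mathrm H}$, $\underline{\dim}_{\mathrm B}$, $\overline{\dim}_{\mathrm B}$ denote Hausdorff, lower box-counting and upper box-counting dimension. $G(n,m)$ is the Grassmannian of $m$-dimensional linear subspaces of $\mathbb{R}^n$, $\gamma_{n,m}$ its natural (rotation-)invariant probability measure, and $\pi_V$ is orthogonal projection onto $V$. Intermediate dimensions. $|U|$ denotes the diameter of a set $U$; covers are countable (finite or infinite). For $0<\theta\le 1$, the lower intermediate dimension $\underline{\dim}_{\,\theta}E$ is the infimum of all $s\ge 0$ such that for all $\epsilon>0$ and all $r_0>0$ there exist $0<r\le r_0$ and a cover $\{U_i\}$ of $E$ with $r^{1/\theta}\le |U_i|\le r$ for all $i$ and $\sum_i |U_i|^s\le\epsilon$. The upper intermediate dimension $\overline{\dim}_{\,\theta}E$ is the infimum of all $s\ge 0$ such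 that for all $\epsilon>0$ there exists $r_0>0$ such that for all $0<r\le r_0$ there is a cover $\{U_i\}$ of $E$ with $r^{1/\theta}\le |U_i|\le r$ for all $i$ and $\sum_i |U_i|^s\le\epsilon$. For $\theta=0$ one uses the same definitions with no lower bound on the diameters $|U_i|$, so that $\underline{\dim}_{\,0}E=\overline{\dim}_{\,0}E=\dim_{\mathrm H}E$; for $\theta=1$ one has $\underline{\dim}_{\,1}E=\underline{\dim}_{\mathrm B}E$ and $\overline{\dim}_{\,1}E=\overline{\dim}_{\mathrm B}E$. *)

(* Defs.v *)
From HB Require Import structures.
From mathcomp Require Import all_boot all_order all_algebra.
From mathcomp Require Import all_classical all_reals all_analysis.

Set Implicit Arguments.
Unset Strict Implicit.
Unset Printing Implicit Defensive.

Import Order.TTheory GRing.Theory Num.Theory.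
Import numFieldNormedType.Exports.

Local Open Scope classical_set_scope.
Local Open Scope ring_scope.

(** Euclidean structure of R^n. The norm that the library puts on ['rV[R]_n] is
    the sup norm, whereas diameters and projections are Euclidean here. *)

Definition dot (R : realType) (n : nat) (u v : 'rV[R]_n) : R :=
  \sum_i u 0 i * v 0 i.

Definition enorm (R : realType) (n : nat) (u : 'rV[R]_n) : R :=
  Num.sqrt (dot u u).

(* The [maxe 0] only serves to give the empty set diameter 0. *)
Definition diam (R : realType) (n : nat) (U : set 'rV[R]_n) : \bar R :=
  maxe 0%E (ereal_sup [set (enorm (x - y))%:E | x in U & y in U]).

(** Hausdorff dimension. A countable (finite or infinite) family of sets is
    given by [U : nat -> set _] restricted to an index set [D : set nat]. *)

Definition hausdorff_content (R : realType) (n : nat) (s delta : R)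
    (E : set 'rV[R]_n) : \bar R :=
  ereal_inf [set c | exists (D : set nat) (U : nat -> set 'rV[R]_n),
    [/\ E `<=` cover D U, forall i, D i -> (diam (U i) <= delta%:E)%E
      & c = (\esum_(i in D) diam (U i) `^ s)%E]].

Definition hausdorff_measure (R : realType) (n : nat) (s : R)
    (E : set 'rV[R]_n) : \bar R :=
  ereal_sup [set hausdorff_content s delta E | delta in [set d : R | 0 < d]].

Definition hausdorff_dim (R : realType) (n : nat) (E : set 'rV[R]_n) : \bar R :=
  ereal_inf [set s%:E | s in [set s : R | 0 <= s /\ hausdorff_measure s E = 0%E]].

(** Box-counting dimensions. *)

Definition covering_number (R : realType) (n : nat) (E : set 'rV[R]_n) (r : R)
    : \bar R :=
  ereal_inf [set k%:R%:E | k in [set k : nat |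
    exists U : nat -> set 'rV[R]_n,
      E `<=` cover `I_k U /\ forall i, `I_k i -> (diam (U i) <= r%:E)%E]].

Definition lower_box_dim (R : realType) (n : nat) (E : set 'rV[R]_n) : \bar R :=
  limf_einf (fun r : R => (lne (covering_number E r) * ((- ln r)^-1)%:E)%E) 0^'+.

Definition upper_box_dim (R : realType) (n : nat) (E : set 'rV[R]_n) : \bar R :=
  limf_esup (fun r : R => (lne (covering_number E r) * ((- ln r)^-1)%:E)%E) 0^'+.

(** Intermediate dimensions. *)

(* For [theta = 0] there is no lower bound on the diameters. *)
Definition intermediate_cover (R : realType) (n : nat) (E : set 'rV[R]_n)
    (theta r : R) (D : set nat) (U : nat -> set 'rV[R]_n) : Prop :=
  E `<=` cover D U /\
  forall i, D i ->
    (0 < theta -> ((r `^ theta^-1)%:E <= diam (U i))%E) /\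
    (diam (U i) <= r%:E)%E.

Definition lower_intermediate_dim (R : realType) (n : nat)
    (E : set 'rV[R]_n) (theta : R) : \bar R :=
  ereal_inf [set s%:E | s in [set s : R | 0 <= s /\
    forall eps r0 : R, 0 < eps -> 0 < r0 ->
      exists r : R, (0 < r /\ r <= r0) /\
      exists (D : set nat) (U : nat -> set 'rV[R]_n),
        intermediate_cover E theta r D U /\
        (\esum_(i in D) diam (U i) `^ s <= eps%:E)%E]].

Definition upper_intermediate_dim (R : realType) (n : nat)
    (E : set 'rV[R]_n) (theta : R) : \bar R :=
  ereal_inf [set s%:E | s in [set s : R | 0 <= s /\
    forall eps : R, 0 < eps ->
      exists r0 : R, 0 < r0 /\
      forall r : R, 0 < r -> r <= r0 ->
      exists (D : set nat) (U : nat -> set 'rV[R]_n),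
        intermediate_cover E theta r D U /\
        (\esum_(i in D) diam (U i) `^ s <= eps%:E)%E]].

(** Orthogonal projections. *)

Definition orthoproj (R : realType) (n : nat) (V : {vspace 'rV[R]_n})
    (x : 'rV[R]_n) : 'rV[R]_n :=
  xget 0 [set v | v \in V /\ forall w, w \in V -> dot (x - v) w = 0].

Lemma dotDl (R : realType) n (a : R) (u v w : 'rV[R]_n) :
  dot (a *: u + v) w = a * dot u w + dot v w.
Proof.
rewrite /dot mulr_sumr -big_split; apply: eq_bigr => i _ /=.
by rewrite !mxE mulrDl mulrA.
Qed.

Lemma dotC (R : realType) n (u v : 'rV[R]_n) : dot u v = dot v u.
Proof. by rewrite /dot; apply: eq_bigr => i _; rewrite mulrC. Qed.

Lemma dot_eq0 (R : realType) n (u : 'rV[R]_n) : dot u u = 0 -> u = 0.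
Proof.
move=> /eqP; rewrite /dot psumr_eq0 => [/allP u0|i _]; last by rewrite -expr2 sqr_ge0.
apply/rowP => i; rewrite mxE; apply/eqP.
by have := u0 i (mem_index_enum i); rewrite /= -expr2 sqrf_eq0.
Qed.

Lemma orthoproj_ex (R : realType) n (s : seq 'rV[R]_n) (x : 'rV[R]_n) :
  exists v, v \in span s /\ forall w, w \in span s -> dot (x - v) w = 0.
Proof.
elim: s x => [|u s IHs] x.
  exists 0; split=> [|w]; first exact: mem0v.
  rewrite span_nil memv0 => /eqP ->.
  by rewrite /dot big1 // => i _; rewrite !mxE mulr0.
have [p [ps pP]] := IHs u; have [q [qs qP]] := IHs x.
have uE : u = (u - p) + p by rewrite subrK.
set t := u - p in uE pP *.
pose c := dot x t / dot t t.
have ss : (span s <= span (u :: s))%VS by rewrite span_cons addvSr.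
have ut : t \in span (u :: s).
  apply: rpredB; last exact: (subvP ss).
  by rewrite memv_span ?mem_head.
exists (c *: t + q); split=> [|w].
  by apply: rpredD; [exact: rpredZ | exact: (subvP ss)].
rewrite span_cons => /memv_addP[_ /vlineP[k ->]] [z zs ->].
have tE y : y \in span s -> dot t y = 0 by exact: pP.
have xE y : dot (x - (c *: t + q)) y = dot (x - q) y - c * dot t y.
  have -> : x - (c *: t + q) = - c *: t + (x - q).
    by rewrite opprD scaleNr addrCA.
  by rewrite dotDl mulNr addrC.
have t0 : dot (x - (c *: t + q)) t = 0.
  have -> : dot (x - (c *: t + q)) t = dot x t - c * dot t t.
    rewrite xE; congr (_ - _).
    have -> : x - q = -1 *: q + x by rewrite scaleN1r addrC.
    by rewrite dotDl (dotC q) (tE q qs) mulr0 add0r.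
  rewrite /c; have [tt0|tt0] := eqVneq (dot t t) 0; last by rewrite divfK ?subrr.
  rewrite (dot_eq0 tt0) /dot [X in X - _]big1 ?[X in _ * X]big1 ?mulr0 ?subrr //.
  - by move=> i _; rewrite !mxE mulr0.
  - by move=> i _; rewrite !mxE mulr0.
have s0 y : y \in span s -> dot (x - (c *: t + q)) y = 0.
  by move=> ys; rewrite xE qP // tE // mulr0 subrr.
have dotDr a v y : dot (x - (c *: t + q)) (a *: v + y) =
    a * dot (x - (c *: t + q)) v + dot (x - (c *: t + q)) y.
  by rewrite dotC dotDl !(dotC _ (x - _)).
rewrite dotDr (s0 z zs) addr0 uE -[X in X + p]scale1r dotDr t0 (s0 p ps).
by rewrite !(mulr0, addr0).
Qed.

(* [orthoproj V x] is the unique point of V such that x minus it is orthogonal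
   to V; the default value of [xget] is never used. *)
Lemma orthoprojP (R : realType) n (V : {vspace 'rV[R]_n}) (x : 'rV[R]_n) :
  orthoproj V x \in V /\ forall w, w \in V -> dot (x - orthoproj V x) w = 0.
Proof.
have [v vP] := orthoproj_ex (vbasis V) x.
rewrite (span_basis (vbasisP V)) in vP.
rewrite /orthoproj; case: xgetP => [y _ //|/(_ v) nP].
by case: (nP vP).
Qed.

(** The Grassmannian. The proof of [m <= n] makes the type inhabited, as is
    required of measurable spaces in the library. *)

Definition grassmannian (R : realType) (n m : nat) (hmn : (m <= n)%N) : Type :=
  {V : {vspace 'rV[R]_n} | \dim V == m}.

Definition subspace_of (R : realType) (n m : nat) (hmn : (m <= n)%N)
    (V : grassmannian R hmn) : {vspace 'rV[R]_n} := val V.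

Lemma grassmannian_inhabited (R : realType) (n m : nat) (hmn : (m <= n)%N) :
  \dim (span (take m (vbasis (fullv : {vspace 'rV[R]_n})))) == m.
Proof.
have /andP[_ fr] := vbasisP (fullv : {vspace 'rV[R]_n}).
have := fr; rewrite -{1}(cat_take_drop m (vbasis _)) => /catl_free /eqP ->.
by rewrite size_takel // size_tuple dimvf; rewrite [dim _]mul1n.
Qed.

HB.instance Definition _ (R : realType) (n m : nat) (hmn : (m <= n)%N) :=
  Choice.copy (grassmannian R hmn) {V : {vspace 'rV[R]_n} | \dim V == m}.

HB.instance Definition _ (R : realType) (n m : nat) (hmn : (m <= n)%N) :=
  isPointed.Build (grassmannian R hmn)
    (Sub (span (take m (vbasis (fullv : {vspace 'rV[R]_n}))))
         (grassmannian_inhabited R hmn)).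

Definition proj_matrix (R : realType) (n m : nat) (hmn : (m <= n)%N)
    (V : grassmannian R hmn) : 'M[R]_n :=
  lin1_mx (orthoproj (subspace_of V)).

(* The usual topology, given by the distance ||pi_V - pi_W||. *)
HB.instance Definition _ (R : realType) (n m : nat) (hmn : (m <= n)%N) :=
  PointedTopological.copy (grassmannian R hmn)
    (initial_topology (@proj_matrix R n m hmn)).

Definition borel_grassmannian (R : realType) (n m : nat) (hmn : (m <= n)%N) :=
  g_sigma_algebraType (@open (grassmannian R hmn)).

(* Rotations act on row vectors by [x |-> x *m g]. *)
Definition is_rotation (R : realType) (n : nat) (g : 'M[R]_n) : Prop :=
  g *m g^T = 1%:M /\ \det g = 1.

Definition rotate (R : realType) (n m : nat) (hmn : (m <= n)%N) (g : 'M[R]_n)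
    (A : set (grassmannian R hmn)) : set (grassmannian R hmn) :=
  [set W | exists2 V, A V &
    subspace_of W = (linfun (mulmxr g) @: subspace_of V)%VS].

(* Since SO(n) is compact and acts transitively on G(n,m), exactly one Borel
   probability measure on G(n,m) has this property: the natural measure
   gamma_{n,m}. *)
Definition rotation_invariant (R : realType) (n m : nat) (hmn : (m <= n)%N)
    (gamma : probability (borel_grassmannian R hmn) R) : Prop :=
  forall (g : 'M[R]_n) (A : set (borel_grassmannian R hmn)),
    is_rotation g -> measurable A -> gamma (rotate g A) = gamma A.

(* Main.v *)
(** If [dim_H E >= m], then for [s < m] every finite tree of dyadic cells meeting [E]
    carries a probability [p] with [p(Q) <= C 2^-(js)] for cells [Q] of level [j <= k]
    (max-flow min-cut, the cuts being covers). Rotation invariance of [gamma] gives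
    [gamma {V | |pi_V x| <= r} <= C (r / |x|)^m], so the mean over [V] of the
    [p * p]-mass of pairs whose projections are [2^-k]-close is at most [C 2^-(ks)].
    By Cauchy-Schwarz a small mass forces a large covering number of [pi_V E], and
    Borel-Cantelli over [k] yields [lower_box_dim (pi_V E) >= m] almost surely. Only
    finitely supported measures are used, so [E] needs no measurability.

    Conversely let [pi_V E] have box dimension [m] for a single [V]. If [s < m] were
    admissible for [dim_theta E], projecting the cover and subdividing each piece of
    diameter [d] into [C (d / delta)^m] pieces of diameter [delta = r^(1/theta)] would
    give [N_delta (pi_V E) <= delta^-(m - theta (m - s))], a contradiction. Hence
    [dim_theta E >= m] for all [theta] in (0, 1], and continuity at 0 concludes. *)
Require Import Defs.
From HB Require Import structures.
From mathcomp Require Import all_boot all_order all_algebra.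
From mathcomp Require Import all_classical all_reals all_analysis.
From mathcomp Require Import measurable_realfun.
From mathcomp Require Import ring lra zify.

Set Implicit Arguments.
Unset Strict Implicit.
Unset Printing Implicit Defensive.

Import Order.TTheory GRing.Theory Num.Theory.
Import numFieldNormedType.Exports.

Local Open Scope classical_set_scope.
Local Open Scope ring_scope.

(** * Euclidean geometry and orthogonal projections *)

Section Euclidean.
Variables (R : realType) (n : nat).
Implicit Types (u v w x y : 'rV[R]_n) (V U : {vspace 'rV[R]_n}).

Lemma dotE u v : dot u v = (u *m v^T) 0 0.
Proof. by rewrite mxE; apply: eq_bigr => i _; rewrite mxE. Qed.

Lemma dotD u v w : dot (u + v) w = dot u w + dot v w.
Proof. by rewrite !dotE mulmxDl mxE. Qed.

Lemma dotZ a u v : dot (a *: u) v = a * dot u v.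
Proof. by rewrite !dotE -scalemxAl mxE. Qed.

Lemma dotN u v : dot (- u) v = - dot u v.
Proof. by rewrite !dotE mulNmx mxE. Qed.

Lemma dotB u v w : dot (u - v) w = dot u w - dot v w.
Proof. by rewrite dotD dotN. Qed.

Lemma dotZr a u v : dot v (a *: u) = a * dot v u.
Proof. by rewrite !(dotC v) dotZ. Qed.

Lemma dotBr u v w : dot w (u - v) = dot w u - dot w v.
Proof. by rewrite !(dotC w) dotB. Qed.

Lemma dot0 u : dot 0 u = 0.
Proof. by rewrite dotE mul0mx mxE. Qed.

Lemma dot_suml (I : Type) (r : seq I) (P : pred I) (F : I -> 'rV[R]_n) v :
  dot (\sum_(i <- r | P i) F i) v = \sum_(i <- r | P i) dot (F i) v.
Proof.
apply: (big_morph (fun u => dot u v)); last exact: dot0.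
by move=> ? ?; rewrite dotD.
Qed.

Lemma dot_ge0 u : 0 <= dot u u.
Proof. by apply: sumr_ge0 => i _; rewrite -expr2 sqr_ge0. Qed.

Lemma dot_gt0 u : u != 0 -> 0 < dot u u.
Proof. by move=> u0; rewrite lt0r dot_ge0 andbT; apply: contra u0 => /eqP/dot_eq0->. Qed.

Lemma enorm_ge0 u : 0 <= enorm u.
Proof. exact: sqrtr_ge0. Qed.

Lemma sqr_enorm u : enorm u ^+ 2 = dot u u.
Proof. by rewrite sqr_sqrtr ?dot_ge0. Qed.

Lemma enorm_le u r : 0 <= r -> (enorm u <= r) = (dot u u <= r ^+ 2).
Proof. by move=> r0; rewrite -sqr_enorm ler_pXn2r // ?nnegrE ?enorm_ge0. Qed.

Lemma enorm_gt0 u : u != 0 -> 0 < enorm u.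
Proof. by move=> u0; rewrite sqrtr_gt0 dot_gt0. Qed.

Lemma enormZ a u : enorm (a *: u) = `|a| * enorm u.
Proof.
apply/eqP; rewrite -(@eqrXn2 _ 2) ?mulr_ge0 ?enorm_ge0 //.
by rewrite exprMn !sqr_enorm dotZ dotZr mulrA real_normK ?num_real.
Qed.

Lemma enorm0 : enorm (0 : 'rV[R]_n) = 0.
Proof. by rewrite /enorm dot0 sqrtr0. Qed.

Lemma enorm_coord_le u i : `|u 0 i| <= enorm u.
Proof.
rewrite -(@ler_pXn2r _ 2) ?nnegrE ?enorm_ge0 // sqr_enorm real_normK ?num_real //.
rewrite /dot (bigD1 i) //= -expr2 lerDl.
by apply: sumr_ge0 => j _; rewrite -expr2 sqr_ge0.
Qed.

Definition orthonormal (s : seq 'rV[R]_n) :=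
  forall i j, (i < size s)%N -> (j < size s)%N -> dot s`_i s`_j = (i == j)%:R.

Lemma orthonormal_free s : orthonormal s -> free s.
Proof.
move=> os; apply/(@freeP _ _ _ (in_tuple s)) => k k0 i.
have := congr1 (fun v => dot v s`_i) k0; rewrite dot0 dot_suml (bigD1 i) //=.
rewrite dotZ os ?ltn_ord // eqxx mulr1 big1 ?addr0 // => j ji.
rewrite dotZ os ?ltn_ord // (_ : (_ == _) = false) ?mulr0 //.
exact: negbTE.
Qed.

(** One Gram-Schmidt step: a vector of [U] outside the span of [s] minus its projection onto that
    span is nonzero and orthogonal to [s], and can be normalised. *)
Lemma orthonormal_step U s : orthonormal s -> (size s < \dim U)%N ->
  {subset s <= U} -> exists2 t, t \in U & orthonormal (rcons s t).
Proof.
move=> os sU sub.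
have [u uU us] : exists2 u, u \in U & u \notin span s.
  apply: contrapT => H; have : (U <= span s)%VS.
    apply/subvP => u uU; apply: contrapT => us; apply: H; exists u => //.
    exact/negP.
  by move=> /dimvS; rewrite leqNgt (leq_ltn_trans (dim_span s)).
have [pS pO] := orthoprojP (span s) u.
set t := u - _ in pO.
have t0 : t != 0.
  by apply: contra us; rewrite subr_eq0 => /eqP ->.
exists ((enorm t)^-1 *: t).
  have /subvP sp : (span s <= U)%VS by exact/span_subvP.
  by rewrite rpredZ // rpredB // sp.
have tt : dot ((enorm t)^-1 *: t) ((enorm t)^-1 *: t) = 1.
  rewrite dotZ dotZr mulrA -invfM -expr2 sqr_enorm mulVf //.
  by rewrite gt_eqF // dot_gt0.
have ts i : (i < size s)%N -> dot ((enorm t)^-1 *: t) s`_i = 0.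
  by move=> si; rewrite dotZ pO ?mulr0 // memv_span // mem_nth.
move=> i j; rewrite size_rcons !ltnS !nth_rcons.
case: (ltngtP i) => [si _|//|-> _]; case: (ltngtP j (size s)) => [sj _|//|sj _].
- exact: os.
- by rewrite sj dotC ts // ltn_eqF.
- by rewrite ts // gtn_eqF.
- by rewrite tt.
Qed.

Lemma orthonormal_extend U s : orthonormal s -> {subset s <= U} ->
  exists2 s', {subset s ++ s' <= U} &
    orthonormal (s ++ s') /\ size (s ++ s') = \dim U.
Proof.
move=> os sU.
have : (size s <= \dim U)%N.
  by rewrite -(eqP (orthonormal_free os)) dimvS //; exact/span_subvP.
move=> /subnK; move: (_ - _)%N => k; elim: k s os sU => [|k IH] s os sU.
  by move=> dk; exists [::]; rewrite cats0.
move=> dk; have [|t tU ot] := @orthonormal_step U s os _ sU.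
  by rewrite -dk addSn ltnS leq_addl.
have [||s' s'U [os' ds']] := IH _ ot.
- by move=> x; rewrite mem_rcons inE => /orP[/eqP ->//|/sU].
- by rewrite size_rcons addnS -addSn.
by exists (t :: s'); rewrite -cat_rcons.
Qed.

(** An orthonormal basis of [V] completed to one of the whole space. Only Parseval's identity and
    the coordinates of the projection are recorded; later counting arguments use nothing else. *)
Lemma adapted_basis V : exists e : 'I_n -> 'rV[R]_n,
  (forall x, dot x x = \sum_i dot x (e i) ^+ 2) /\
  (forall x i, dot (orthoproj V x) (e i) = if (i < \dim V)%N then dot x (e i) else 0).
Proof.
have [|//|s sV [os ds]] := @orthonormal_extend V [::]; first by case.
rewrite cat0s in sV os ds.
have [//|s' _ [oss' dss']] := @orthonormal_extend fullv s os.
  by move=> x _; rewrite memvf.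
have {}dss' : size (s ++ s') = n by rewrite dss' dimvf [dim _]mul1n.
exists (fun i => (s ++ s')`_i); split => [x|x i].
  pose O : 'M[R]_n := \matrix_i (s ++ s')`_i.
  have OE y i : (y *m O^T) 0 i = dot y (s ++ s')`_i.
    by rewrite mxE; apply: eq_bigr => j _; rewrite !mxE.
  have OO : O *m O^T = 1%:M.
    apply/matrixP => i j; rewrite !mxE -(oss' i j) ?dss' ?ltn_ord //.
    by apply: eq_bigr => k _; rewrite !mxE.
  (* Orthonormality gives [O O^T = 1]; Parseval needs [O^T O = 1]. *)
  have {}OO := mulmx1C OO.
  have xO : x *m x^T = (x *m O^T) *m (x *m O^T)^T.
    by rewrite trmx_mul trmxK mulmxA -(mulmxA x) OO mulmx1.
  rewrite dotE xO mxE; apply: eq_bigr => i _.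
  by rewrite [X in _ * X]mxE !OE expr2.
have [pV pO] := orthoprojP V x; set v := orthoproj V x in pV pO *.
have sV' : span s = V.
  apply/eqP; rewrite eqEdim; apply/andP; split; first exact/span_subvP.
  by rewrite (eqP (orthonormal_free os)) ds.
case: ifP => [im|/negbT]; rewrite nth_cat ds.
  rewrite im; have := pO s`_i; rewrite dotB => /(_ _)/eqP.
  by rewrite subr_eq0 => /(_ _)/eqP->//; rewrite sV // mem_nth ?ds.
rewrite -leqNgt leqNgt => /negbTE im; rewrite im.
have si j : (j < size s)%N -> dot s`_j s'`_(i - \dim V) = 0.
  move=> js; have jn : (j < size (s ++ s'))%N.
    by rewrite size_cat (leq_trans js) // leq_addr.
  have := oss' j i jn; rewrite dss' !nth_cat js ds im => -> //.
  rewrite (_ : (_ == _) = false) //.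
  by apply: contraFF im => /eqP <-; rewrite -ds.
rewrite -sV' in pV; rewrite (@coord_span _ _ _ (in_tuple s) v pV) dot_suml.
by rewrite big1 // => j _; rewrite dotZ si ?mulr0.
Qed.

End Euclidean.

Section Projection.
Variables (R : realType) (n : nat).
Implicit Types (u v w x y : 'rV[R]_n) (V : {vspace 'rV[R]_n}).

Lemma orthoproj_uniq V x v : v \in V ->
  (forall w, w \in V -> dot (x - v) w = 0) -> orthoproj V x = v.
Proof.
move=> vV vo; have [pV po] := orthoprojP V x.
apply/eqP; rewrite -subr_eq0; apply/eqP/dot_eq0.
have dV : orthoproj V x - v \in V by rewrite rpredB.
have {1}-> : orthoproj V x - v = (x - v) - (x - orthoproj V x).
  by rewrite opprB [RHS]addrC subrKA.
by rewrite dotB vo // po // subrr.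
Qed.

Lemma orthoproj_is_linear V : linear (orthoproj V).
Proof.
move=> a x y; have [pV po] := orthoprojP V x; have [qV qo] := orthoprojP V y.
apply: orthoproj_uniq => [|w wV]; first by rewrite rpredD ?rpredZ.
by rewrite opprD addrACA -scalerBr dotD dotZ po // qo // mulr0 addr0.
Qed.

Lemma orthoprojB V x y : orthoproj V (x - y) = orthoproj V x - orthoproj V y.
Proof.
by have := orthoproj_is_linear V (-1) y x; rewrite !scaleN1r ![- _ + _]addrC.
Qed.

Lemma orthoprojZ V a x : orthoproj V (a *: x) = a *: orthoproj V x.
Proof.
have o0 : orthoproj V 0 = 0 by rewrite -(subrr 0) orthoprojB !subrr.
by rewrite -[a *: x]addr0 orthoproj_is_linear o0 addr0.
Qed.

Lemma dot_orthoproj_le V x : dot (orthoproj V x) (orthoproj V x) <= dot x x.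
Proof.
have [e [eP pP]] := adapted_basis V; rewrite !eP ler_sum // => i _; rewrite pP.
by case: ifP => // _; rewrite expr0n /= sqr_ge0.
Qed.

Lemma enorm_orthoproj_le V x : enorm (orthoproj V x) <= enorm x.
Proof. by rewrite enorm_le ?enorm_ge0 // sqr_enorm dot_orthoproj_le. Qed.

(** * Rotations *)

(** Sylvester's identity: both products of block triangular matrices equal the block matrix with
    rows [(1, v)] and [(u^T, 1)], so their determinants agree. *)
Lemma det_sub_rank1 u v : \det (1%:M - u^T *m v) = 1 - dot v u.
Proof.
have E : block_mx 1%:M 0 u^T 1%:M *m block_mx 1%:M v 0 (1%:M - u^T *m v) =
    block_mx 1%:M v 0 1%:M *m block_mx (1%:M - v *m u^T) 0 u^T 1%:M.
  rewrite !mulmx_block !(mul1mx, mulmx1, mul0mx, mulmx0, addr0, add0r).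
  by rewrite subrK addrC subrK.
have := congr1 (@determinant _ _) E.
rewrite !det_mulmx !(det_lblock, det_ublock) !det1 !mul1r mulr1 => ->.
by rewrite det_mx11 !mxE dotE !mxE eqxx mulr1n.
Qed.

(** The reflection in the hyperplane orthogonal to [u], acting on row vectors from the right. *)
Definition householder u : 'M[R]_n := 1%:M - ((2 / dot u u) *: u)^T *m u.

Lemma mul_householder u x :
  x *m householder u = x - (2 * dot x u / dot u u) *: u.
Proof.
rewrite mulmxBr mulmx1 mulmxA [x *m _^T]mx11_scalar -dotE dotZr mul_scalar_mx.
by rewrite mulrAC.
Qed.

Lemma det_householder u : u != 0 -> \det (householder u) = -1.
Proof.
move=> u0; rewrite det_sub_rank1 dotZr divfK ?gt_eqF ?dot_gt0 //; ring.
Qed.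

Lemma householderK u x : u != 0 -> x *m householder u *m householder u = x.
Proof.
move=> u0; rewrite !mul_householder dotB dotZ.
have d0 : dot u u != 0 by rewrite gt_eqF ?dot_gt0.
rewrite -addrA -opprD -scalerDl.
have -> : 2 * dot x u / dot u u +
   2 * (dot x u - 2 * dot x u / dot u u * dot u u) / dot u u = 0 by field.
by rewrite scale0r subr0.
Qed.

Lemma householder_orthogonal u : u != 0 ->
  householder u *m (householder u)^T = 1%:M.
Proof.
move=> u0; have -> : (householder u)^T = householder u.
  rewrite /householder linearB /= trmx1 trmx_mul trmxK; congr (_ - _).
  by rewrite -scalemxAr linearZ /= -scalemxAl.
apply/row_matrixP => i.
by rewrite -[_ *m _ in LHS]mul1mx mulmxA !row_mul householderK.
Qed.

Lemma is_rotationM (g h : 'M[R]_n) : g *m g^T = 1%:M -> h *m h^T = 1%:M ->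
  \det g * \det h = 1 -> is_rotation (g *m h).
Proof.
move=> gg hh d; split; last by rewrite det_mulmx.
by rewrite trmx_mul mulmxA -(mulmxA g) hh mulmx1.
Qed.

(** The reflection along [x - y] sends [x] to [y] but has determinant -1. A second reflection, along
    some [w] orthogonal to [y], fixes [y] and restores the determinant; such a [w] exists because
    [n > 1]. *)
Lemma rotation_transitive x y : (1 < n)%N -> enorm x = enorm y ->
  exists2 g : 'M[R]_n, is_rotation g & x *m g = y.
Proof.
move=> n1 xy; have [->|nxy] := eqVneq x y.
  by exists 1%:M; rewrite ?mulmx1 //; split; rewrite ?trmx1 ?mulmx1 ?det1.
have [w w0 wy] : exists2 w, w != 0 & dot y w = 0.
  have [u uy] : exists u, u \notin <[y]>%VS.
    apply: contrapT => H; have : (fullv <= <[y]>)%VS.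
      apply/subvP => u _; apply: contrapT => uy; apply: H; exists u.
      exact/negP.
    move=> /dimvS; rewrite dimvf [dim _]mul1n dim_vline => nle.
    by have := leq_trans n1 (leq_trans nle (leq_b1 _)).
  have [pV po] := orthoprojP <[y]> u.
  exists (u - orthoproj <[y]> u); last by rewrite dotC po // memv_line.
  by apply: contra uy; rewrite subr_eq0 => /eqP ->.
have d0 : x - y != 0 by rewrite subr_eq0.
exists (householder (x - y) *m householder w).
  by apply: is_rotationM; rewrite ?householder_orthogonal // !det_householder // mulrNN mulr1.
have hx : x *m householder (x - y) = y.
  have xx : dot x x = dot y y by rewrite -!sqr_enorm xy.
  (* Equality of the norms makes the coefficient of the reflection exactly 1. *)
  have E : dot (x - y) (x - y) = 2 * dot x (x - y).
    rewrite dotB !dotBr xx (dotC y x); ring.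
  rewrite mul_householder -E divff ?scale1r ?gt_eqF ?dot_gt0 //.
  by rewrite opprB addrC subrK.
by rewrite mulmxA hx mul_householder wy mulr0 mul0r scale0r subr0.
Qed.

End Projection.

(** * Action of rotations on subspaces, and measurability of the event that a projection is short *)

Section Grassmannian.
Variables (R : realType) (n m : nat) (hmn : (m <= n)%N).
Implicit Types (x : 'rV[R]_n) (V W : grassmannian R hmn).

Lemma mul_proj_matrix V x : x *m proj_matrix V = orthoproj (subspace_of V) x.
Proof.
pose L := GRing.isLinear.Build R _ _ _ _ (orthoproj_is_linear (subspace_of V)).
pose f : {linear 'rV[R]_n -> 'rV[R]_n} := HB.pack (orthoproj (subspace_of V)) L.
exact: (mul_rV_lin1 f).
Qed.

Definition small_proj x (r : R) : set (borel_grassmannian R hmn) :=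
  [set V | enorm (orthoproj (subspace_of V) x) <= r].

(** A rotation preserves [dot], hence carries the orthogonal decomposition along [V] to the one
    along the image of [V]. *)
Lemma orthoproj_rotate (g : 'M[R]_n) (V : {vspace 'rV[R]_n}) x :
  is_rotation g ->
  orthoproj (linfun (mulmxr g) @: V)%VS (x *m g) = orthoproj V x *m g.
Proof.
move=> [gg _]; have [pV po] := orthoprojP V x.
apply: orthoproj_uniq => [|w /memv_imgP[z zV ->]].
  by rewrite -[_ *m g](lfunE (mulmxr g)) memv_img.
rewrite lfunE /= -mulmxBl dotE trmx_mul mulmxA -(mulmxA _ g) gg mulmx1.
by rewrite -dotE po.
Qed.

Lemma enorm_rotate (g : 'M[R]_n) x : is_rotation g -> enorm (x *m g) = enorm x.
Proof.
by move=> [gg _]; rewrite /enorm !dotE trmx_mul mulmxA -(mulmxA _ g) gg mulmx1.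
Qed.

Lemma rotate_small_proj (g : 'M[R]_n) x r : is_rotation g ->
  rotate (hmn := hmn) g (small_proj x r) = small_proj (x *m g) r.
Proof.
move=> rg; apply/seteqP; split => W.
  by move=> [V Vr WV]; rewrite /small_proj /= WV orthoproj_rotate // enorm_rotate.
have [gg dg] := rg; have gg' := mulmx1C gg.
(* Every [W] is the rotated image of a subspace of the same dimension, namely of its image under the
   inverse rotation [g^T]. *)
pose f : 'Hom('rV[R]_n, 'rV[R]_n) := linfun (mulmxr g^T).
have fdim : \dim (f @: subspace_of W)%VS == m.
  rewrite limg_dim_eq; first exact: (valP W).
  apply/eqP; rewrite -subv0; apply/subvP => w; rewrite memv_cap memv_ker lfunE /=.
  move=> /andP[_ /eqP /(congr1 (mulmx^~ g))].
  by rewrite /= -mulmxA gg' mulmx1 mul0mx memv0 => ->.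
have WE : subspace_of W = (linfun (mulmxr g) @: (f @: subspace_of W))%VS.
  apply/vspaceP => w; rewrite -limg_comp.
  suff -> : (linfun (mulmxr g) \o f)%VF = \1%VF by rewrite lim1g.
  by apply/lfunP => z; rewrite comp_lfunE !lfunE /= -mulmxA gg' mulmx1.
move=> Wr; exists (exist _ (f @: subspace_of W)%VS fdim : grassmannian R hmn); last exact: WE.
rewrite /small_proj /= in Wr *; move: Wr.
by rewrite {1}WE orthoproj_rotate // enorm_rotate.
Qed.

(** The event is closed: it is the preimage of a closed sublevel set under [proj_matrix], which is
    continuous by the choice of topology. A negative [r] is treated apart because norms are compared
    through their squares. *)
Lemma measurable_small_proj x r : measurable (small_proj x r).
Proof.
have [r0|r0] := ltP r 0.
  rewrite (_ : small_proj x r = set0) //; apply/seteqP; split => // V /=.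
  by rewrite /small_proj /= leNgt (lt_le_trans r0) // enorm_ge0.
rewrite -[small_proj x r]setCK; apply: measurableC; apply: sub_sigma_algebra.
pose h (M : 'M[R]_n) : R := dot (x *m M) (x *m M).
have sumc (F : 'I_n -> 'M[R]_n -> R) : (forall i, continuous (F i)) ->
    continuous (fun M => \sum_i F i M).
  move=> Fc; apply: (@continuous_big R _ +%R 0 xpredT _ _ (index_enum _) F) => //.
  exact: (@add_continuous R).
have c j : continuous (fun N : 'M[R]_n => (x *m N) 0 j).
  rewrite (_ : (fun N : 'M[R]_n => _) = fun N => \sum_k x 0 k * N k j); last first.
    by apply/funext => N; rewrite mxE.
  by apply: sumc => k M; apply: continuousM; [exact: cst_continuous|exact: coord_continuous].
have hc : continuous h by apply: sumc => j M; apply: continuousM; exact: c.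
have -> : small_proj x r = @proj_matrix R n m hmn @^-1` (h @^-1` [set y | y <= r ^+ 2]).
  apply/seteqP; split => V; rewrite /small_proj /= enorm_le // /h mul_proj_matrix //.
apply: closed_openC; apply: preimage_closed => [V _|]; first exact: initial_continuous.
by apply: preimage_closed => [M _|]; [exact: hc|exact: closed_le].
Qed.

End Grassmannian.

Arguments small_proj {R n m} hmn x r.
Arguments measurable_small_proj {R n m} hmn x r.

(** * Expectation of a weighted sum of events *)

Section WeightedEvents.
Context d (T : measurableType d) (R : realType) (P : probability T R).
Variables (I : finType) (w : I -> R) (A : I -> set T).
Hypotheses (w0 : forall i, 0 <= w i) (mA : forall i, measurable (A i)).

Let f x : R := \sum_i w i * \1_(A i) x.

Let f0 x : 0 <= f x.
Proof. by apply: sumr_ge0 => i _; rewrite mulr_ge0 // indicE. Qed.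

Lemma measurable_weighted_events : measurable_fun setT f.
Proof. by apply: measurable_sum => i; apply: measurable_funM => //; exact: measurable_indic. Qed.

Lemma integral_weighted_events :
  (\int[P]_x (f x)%:E = (\sum_i w i * fine (P (A i)))%:E)%E.
Proof.
transitivity (\int[P]_x (\sum_(i <- index_enum I) ((w i)%:E * (\1_(A i) x)%:E)))%E.
  by apply: eq_integral => x _; rewrite /f -sumEFin; apply: eq_bigr => i _; rewrite EFinM.
have mi i : measurable_fun setT (fun x => (\1_(A i) x)%:E : \bar R).
  by apply/measurable_EFinP; exact: measurable_indic.
have i0 i x : (0 <= (\1_(A i) x)%:E :> \bar R)%E by rewrite lee_fin indicE.
rewrite ge0_integral_sum //.
- rewrite -sumEFin; apply: eq_bigr => i _.
  rewrite ge0_integralZl // ?lee_fin // integral_indic // setIT EFinM fineK //.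
  exact: fin_num_measure.
- by move=> i; exact: measurable_funeM.
- by move=> i x _; rewrite mule_ge0 // lee_fin.
Qed.

Lemma weighted_events_le B : (forall x, f x <= B) ->
  \sum_i w i * fine (P (A i)) <= B.
Proof.
move=> fB; rewrite -lee_fin -integral_weighted_events.
have -> : (B%:E = \int[P]_x (cst B%:E x))%E.
  by rewrite integral_cst // [X in (_ * X)%E]probability_setT mule1.
have B0 : 0 <= B by apply: le_trans (f0 point) (fB _).
apply: ge0_le_integral => //.
- by move=> x _; rewrite lee_fin.
- by apply/measurable_EFinP; exact: measurable_weighted_events.
- by move=> x _; rewrite lee_fin.
Qed.

(** Markov's inequality, which turns a mean energy bound into a bound on the measure of exceptional
    subspaces. *)
Lemma weighted_events_markov (t : R) : 0 < t -> measurable [set x | t <= f x] /\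
  t * fine (P [set x | t <= f x]) <= \sum_i w i * fine (P (A i)).
Proof.
move=> t0; have mS : measurable [set x | t <= f x].
  have -> : [set x | t <= f x] = setT `&` f @^-1` [set` `[t, +oo[].
    by apply/seteqP; split => x /=; rewrite in_itv /= andbT => // -[].
  exact: measurable_weighted_events.
split=> //; rewrite -lee_fin -integral_weighted_events EFinM fineK ?fin_num_measure //.
rewrite -integral_cst //.
apply: (@le_trans _ _ (\int[P]_(x in [set x | (t <= f x)%R]) (f x)%:E)%E).
  apply: ge0_le_integral => //.
  - by move=> x _; rewrite lee_fin ltW.
  - by apply/measurable_EFinP; apply: measurable_funS measurable_weighted_events.
apply: ge0_subset_integral => //.
- by apply/measurable_EFinP; exact: measurable_weighted_events.
- by move=> x _; rewrite lee_fin.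
Qed.

End WeightedEvents.

(** * Grid counting and coverings *)

Section Cells.
Variables (R : realType) (n : nat).
Implicit Types (x y : 'rV[R]_n) (e : 'I_n -> 'rV[R]_n).

(** Points with the same grid indices differ by at most [h] in each of the [n] orthonormal
    coordinates. Here [a] is the lower corner of the box and [(k i).+1] the number of cells in
    direction [i]. *)
Lemma box_cells e (a : 'I_n -> R) (h : R) (k : 'I_n -> nat) (S : set 'rV[R]_n) :
  (forall x, dot x x = \sum_i dot x (e i) ^+ 2) -> 0 < h ->
  (forall x, S x -> forall i, 0 <= dot x (e i) - a i < (k i).+1%:R * h) ->
  exists f : 'rV[R]_n -> 'I_(\prod_i (k i).+1)%N,
    forall x y, S x -> S y -> f x = f y -> dot (x - y) (x - y) <= n%:R * h ^+ 2.
Proof.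
move=> eP h0 Sk; pose T := {dffun forall i : 'I_n, 'I_(k i).+1}.
have cT : #|T| = (\prod_i (k i).+1)%N.
  rewrite card_dep_ffun foldrE big_map big_enum.
  by apply: eq_bigr => i _; rewrite card_ord.
pose c x i := Num.truncn ((dot x (e i) - a i) / h).
(* On [S] the indices are in range, so [inord] does not alter them. *)
pose g x : T := [ffun i => inord (c x i)].
exists (fun x => cast_ord cT (enum_rank (g x))) => x y Sx Sy.
move=> /cast_ord_inj /enum_rank_inj /ffunP gxy.
have cb z i : S z -> (c z i < (k i).+1)%N /\
    (c z i)%:R <= (dot z (e i) - a i) / h < (c z i).+1%:R.
  move=> /Sk /(_ i) /andP[z0 zk]; have z0' : 0 <= (dot z (e i) - a i) / h.
    by rewrite divr_ge0 // ltW.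
  by rewrite truncn_lt_nat // ltr_pdivrMr // zk; split => //; exact: truncn_itv.
rewrite eP -[n in n%:R]card_ord mulr_natl -sumr_const ler_sum // => i _.
rewrite dotB -real_normK ?num_real // ler_pXn2r ?nnegrE ?(ltW h0) //.
have [xk xc] := cb x i Sx; have [yk yc] := cb y i Sy.
have := gxy i; rewrite !ffunE => /(congr1 val); rewrite /= !inordK // => cxy.
rewrite cxy in xc; move: xc yc; set X := dot x _; set Y := dot y _.
rewrite !ler_pdivlMr // !ltr_pdivrMr // => xc yc; move: xc yc.
rewrite -natr1 mulrDl mul1r ler_distl => /andP[? ?] /andP[? ?].
by apply/andP; split; lra.
Qed.

End Cells.

Lemma prod_lt_if (a b m q : nat) :
  (\prod_(i < m + q) (if (i < m)%N then a else b) = a ^ m * b ^ q)%N.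
Proof.
rewrite big_split_ord /=; congr (_ * _)%N.
  rewrite (eq_bigr (fun=> a)) => [|i _]; last by rewrite ltn_ord.
  by rewrite prod_nat_const card_ord.
rewrite (eq_bigr (fun=> b)) => [|i _]; last by rewrite ltnNge leq_addr.
by rewrite prod_nat_const card_ord.
Qed.

Section Coverings.
Variables (R : realType) (n : nat).
Implicit Types (x y : 'rV[R]_n) (A B S U : set 'rV[R]_n) (V : {vspace 'rV[R]_n}).

Lemma diam_leP U (d : R) : 0 <= d ->
  (diam U <= d%:E)%E <-> (forall x y, U x -> U y -> enorm (x - y) <= d).
Proof.
move=> d0; rewrite /diam; split => [|H].
  rewrite ge_max => /andP[_ +] x y Ux Uy; rewrite -lee_fin; apply: le_trans.
  by apply: ereal_sup_ubound; exists x => //; exists y.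
rewrite ge_max lee_fin d0; apply: ge_ereal_sup => _ [x Ux [y Uy <-]].
by rewrite lee_fin H.
Qed.

Lemma diam_ge0 U : (0 <= diam U)%E.
Proof. by rewrite /diam le_max lexx. Qed.

(** The condition on [k] inside the infimum [covering_number A r], isolated so that covers are
    counted by natural numbers. *)
Definition coverable A (r : R) (k : nat) := exists U : nat -> set 'rV[R]_n,
  A `<=` cover `I_k U /\ forall i, `I_k i -> (diam (U i) <= r%:E)%E.

Lemma coverableS A B r k : A `<=` B -> coverable B r k -> coverable A r k.
Proof. by move=> AB [U [BU Ur]]; exists U; split => // x /AB/BU. Qed.

Lemma coverable_le A r r' k : r <= r' -> coverable A r k -> coverable A r' k.
Proof.
move=> rr [U [AU Ur]]; exists U; split => // i /Ur /le_trans; apply.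
by rewrite lee_fin.
Qed.

Lemma coverableU A B r k l : coverable A r k -> coverable B r l ->
  coverable (A `|` B) r (k + l).
Proof.
move=> [U [AU Ur]] [W [BW Wr]].
exists (fun i => if (i < k)%N then U i else W (i - k)%N); split.
  move=> x [/AU[i /= ik Uix]|/BW[i /= il Wix]].
    by exists i; rewrite /= ?ik // ltn_addr.
  by exists (k + i)%N; rewrite /= ?ltn_add2l // ltnNge leq_addr /= addKn.
move=> i /= ikl; case: ltnP => ik; first exact: Ur.
by apply: Wr; rewrite /= ltn_subLR.
Qed.

Lemma coverable_bigcup (I : choiceType) (s : seq I) (A : I -> set 'rV[R]_n) r k :
  (forall i, i \in s -> coverable (A i) r (k i)) ->
  coverable (\bigcup_(i in [set` s]) A i) r (\sum_(i <- s) k i).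
Proof.
elim: s => [|i s IH] H.
  by rewrite big_nil; exists (fun=> set0); split => [x []|i] /=.
have cs := IH (fun j js => H j (@mem_behead _ (i :: s) j js)).
rewrite big_cons; apply: coverableS (coverableU (H i (mem_head _ _)) cs).
move=> x [j /=]; rewrite inE => /orP[/eqP -> Aix|js Ajx]; first by left.
by right; exists j.
Qed.

Lemma covering_number_le A r k : coverable A r k ->
  (covering_number A r <= k%:R%:E)%E.
Proof. by move=> c; apply: ereal_inf_lbound; exists k. Qed.

Lemma covering_number_ge A r (z : \bar R) :
  (forall k, coverable A r k -> (z <= k%:R%:E)%E) -> (z <= covering_number A r)%E.
Proof. by move=> H; apply: le_ereal_inf_tmp => _ [k kA <-]; exact: H. Qed.

(* [S] is cut along a grid of mesh [delta / n] in orthonormal coordinates of [V]. *)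
Lemma subspace_coverable V S (d delta : R) : (0 < n)%N ->
  S `<=` [set` V] -> 0 < delta -> delta <= d ->
  (forall x y, S x -> S y -> enorm (x - y) <= d) ->
  exists2 k, coverable S delta k & k%:R <= (3 * n%:R * (d / delta)) ^+ \dim V.
Proof.
move=> n0 SV dl0 dld Sd; have d0 : 0 < d by exact: lt_le_trans dld.
have n1 : 1 <= n%:R :> R by rewrite ler1n.
have n0' : 0 < n%:R :> R by rewrite ltr0n.
have [->|/set0P[x0 Sx0]] := eqVneq S set0.
  exists 0%N; first by exists (fun=> set0); split => // x [].
  by rewrite exprn_ge0 // mulr_ge0 ?divr_ge0 ?mulr_ge0 // ltW.
have [e [eP pP]] := adapted_basis V.
have mn : (\dim V <= n)%N by have := dimvS (subvf V); rewrite dimvf [dim _]mul1n.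
have SV0 x (i : 'I_n) : S x -> (\dim V <= i)%N -> dot x (e i) = 0.
  move=> /SV /= xV mi; have <- : orthoproj V x = x.
    by apply: orthoproj_uniq => // w _; rewrite subrr dot0.
  by rewrite pP ltnNge mi.
pose h := delta / n%:R; have h0 : 0 < h by rewrite divr_gt0.
(* Along [V] the coordinates of [S] stay within [d] of those of [x0], an interval of length [2 * d];
   off [V] they vanish and one cell suffices. *)
pose K := Num.truncn (2 * d / h).
pose a (i : 'I_n) := if (i < \dim V)%N then dot x0 (e i) - d else 0.
pose k (i : 'I_n) := if (i < \dim V)%N then K else 0%N.
have dh0 : 0 <= 2 * d / h by rewrite divr_ge0 ?mulr_ge0 // ltW.
have [|f fP] := @box_cells R n e a h k S eP h0.
  move=> x Sx i; rewrite /a /k; case: ltnP => im; last first.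
    by rewrite SV0 // subr0 lexx mul1r.
  have : `|dot x (e i) - dot x0 (e i)| <= d.
    apply: le_trans (Sd _ _ Sx Sx0); rewrite -dotB.
    rewrite -(@ler_pXn2r _ 2) ?nnegrE ?enorm_ge0 // sqr_enorm eP real_normK ?num_real //.
    by rewrite (bigD1 i) //= lerDl sumr_ge0 // => j _; rewrite sqr_ge0.
  rewrite ler_distl => /andP[xd dx]; apply/andP; split; first lra.
  have /andP[_] := truncn_itv dh0; rewrite ltr_pdivrMr // -/K; lra.
have NE : (\prod_i (k i).+1)%N = (K.+1 ^ \dim V)%N.
  have := prod_lt_if K.+1 1 (\dim V) (n - \dim V); rewrite exp1n muln1 subnKC // => <-.
  by apply: eq_bigr => i _; rewrite /k; case: ifP.
exists (\prod_i (k i).+1)%N.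
  exists (fun j => [set x | S x /\ f x = j :> nat]); split.
    by move=> x Sx; exists (f x) => //=; exact: ltn_ord.
  move=> j _; apply/diam_leP; first exact: ltW.
  move=> x y [Sx xj] [Sy yj]; rewrite enorm_le; last exact: ltW.
  apply: le_trans (fP x y Sx Sy _) _; first by apply: val_inj; rewrite /= xj yj.
  have -> : n%:R * h ^+ 2 = delta ^+ 2 / n%:R by rewrite /h; field; rewrite gt_eqF.
  by rewrite ler_pdivrMr // ler_peMr ?sqr_ge0.
rewrite NE natrX lerXn2r ?nnegrE ?ler0n //.
  by rewrite mulr_ge0 ?divr_ge0 ?mulr_ge0 // ltW.
rewrite -natr1.
(* The last summand absorbs the rounding in [K.+1], since [h <= delta <= d]. *)
have -> : 3 * n%:R * (d / delta) = 2 * d / h + d / h.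
  by rewrite /h invf_div; field; rewrite gt_eqF.
have /andP[K1 _] := truncn_itv dh0; rewrite lerD // ler_pdivlMr // mul1r.
rewrite /h; apply: le_trans dld; rewrite ler_pdivrMr //.
by rewrite ler_peMr // ltW.
Qed.

End Coverings.

(** * Probability that a projection is short *)

(** In dimension 1 the identity is the only rotation, so only the line of [y] can be reached. The
    sign is harmless because short projections are invariant under [x |-> -x]. *)
Lemma rotation_transitive_sign (R : realType) (n : nat) (x y : 'rV[R]_n) :
  enorm x = enorm y ->
  exists2 g : 'M[R]_n, is_rotation g & x *m g = y \/ x *m g = - y.
Proof.
move=> xy; have [n1|] := ltnP 1 n.
  by have [g gr gx] := rotation_transitive n1 xy; exists g => //; left.
move=> n1; exists 1%:M; first by split; rewrite ?trmx1 ?mulmx1 ?det1.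
rewrite mulmx1; case: n x y xy n1 => [|[|//]] x y xy _.
  by left; apply/rowP => -[].
have : x 0 0 ^+ 2 = y 0 0 ^+ 2.
  by move/(congr1 (fun z => z ^+ 2)): xy; rewrite !sqr_enorm /dot !big_ord1 -!expr2.
move/eqP; rewrite eqf_sqr => /orP[]/eqP xy0; [left|right];
  by apply/rowP => i; rewrite ord1 ?mxE.
Qed.

Section Transversality.
Variables (R : realType) (n m : nat) (hmn : (m <= n)%N).
Variable gamma : probability (borel_grassmannian R hmn) R.
Hypothesis hgamma : rotation_invariant gamma.
Implicit Types (x y : 'rV[R]_n).

Let prob x r : R := fine (gamma (small_proj hmn x r)).

Lemma small_projN x r : small_proj hmn (- x) r = small_proj hmn x r.
Proof.
apply/seteqP; split => V; rewrite /small_proj /=;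
  by rewrite -scaleN1r orthoprojZ enormZ normrN1 mul1r.
Qed.

Lemma prob_small_proj_enorm x y r : enorm x = enorm y -> prob x r = prob y r.
Proof.
move=> /rotation_transitive_sign[g gr xg].
rewrite /prob -(hgamma gr (measurable_small_proj hmn x r)) rotate_small_proj //.
by case: xg => ->; rewrite ?small_projN.
Qed.

(** By invariance [y] may be replaced by a multiple [l *: x] with [l <= 1], whose projection is no
    longer than that of [x], for every [V]. *)
Lemma prob_small_proj_le x y r : enorm y <= enorm x -> prob x r <= prob y r.
Proof.
move=> yx; have [x0|x0] := eqVneq x 0.
  have xy : enorm x = enorm y.
    by apply/eqP; rewrite eq_le yx andbT x0 enorm0 enorm_ge0.
  by rewrite (prob_small_proj_enorm r xy).
pose l := enorm y / enorm x; have l0 : 0 <= l by rewrite divr_ge0 ?enorm_ge0.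
have l1 : l <= 1 by rewrite ler_pdivrMr ?enorm_gt0 // mul1r.
have -> : prob y r = prob (l *: x) r.
  apply: prob_small_proj_enorm; rewrite enormZ ger0_norm // /l divfK //.
  by rewrite gt_eqF ?enorm_gt0.
rewrite fine_le ?fin_num_measure //; try exact: measurable_small_proj.
apply: le_measure; rewrite ?inE; try exact: measurable_small_proj.
move=> V; rewrite /small_proj /= orthoprojZ enormZ ger0_norm // => xr.
by apply: le_trans xr; rewrite ler_piMl // enorm_ge0.
Qed.

Definition grid_point M (z : {ffun 'I_n -> 'I_M}) : 'rV[R]_n := \row_i (z i)%:R.

Lemma enorm_grid_point M (z : {ffun 'I_n -> 'I_M}) : enorm (grid_point z) <= n%:R * M%:R.
Proof.
rewrite enorm_le ?mulr_ge0 // /dot.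
apply: (@le_trans _ _ (\sum_(i < n) M%:R ^+ 2)).
  apply: ler_sum => i _; rewrite !mxE -expr2 lerXn2r ?nnegrE ?ler0n // ler_nat.
  exact/ltnW/ltn_ord.
rewrite sumr_const card_ord exprMn -[_ *+ n]mulr_natl ler_wpM2r ?sqr_ge0 //.
by rewrite -natrX ler_nat -{1}(expn1 n); case: (n) => // k; rewrite leq_pexp2l.
Qed.

(** In coordinates adapted to [V] these grid points lie in a box of side 2 in [m] directions and
    [2 * n * M] in the others. Cells of mesh [h] have diameter below 1, so each contains at most one
    integer point; it remains to count cells. *)
Lemma grid_point_small_proj_card (V : grassmannian R hmn) M :
  (0 < n)%N -> (0 < M)%N ->
  (#|[pred z : {ffun 'I_n -> 'I_M} | (enorm (orthoproj (subspace_of V) (grid_point z)) <= 1)%R]|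
    <= (5 * n ^ 2) ^ n * M ^ (n - m))%N.
Proof.
move=> n0 M0; have n0' : 0 < n%:R :> R by rewrite ltr0n.
have [e [eP pP]] := adapted_basis (subspace_of V).
rewrite (eqP (valP V)) in pP.
set A := [pred z | _].
pose S := [set grid_point z | z in [set z | z \in A]].
pose h : R := (2 * n%:R)^-1; have h0 : 0 < h by rewrite invr_gt0 mulr_gt0.
pose L (i : 'I_n) : R := if (i < m)%N then 1 else n%:R * M%:R.
pose k (i : 'I_n) := if (i < m)%N then (4 * n)%N else (4 * n ^ 2 * M)%N.
have coord_le x i : `|dot x (e i)| <= enorm x.
  rewrite -(@ler_pXn2r _ 2) ?nnegrE ?enorm_ge0 // sqr_enorm eP real_normK ?num_real //.
  by rewrite (bigD1 i) //= lerDl sumr_ge0 // => j _; rewrite sqr_ge0.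
have [|f fP] := @box_cells R n e (fun i => - L i) h k S eP h0.
  move=> _ [z zA <-] i.
  have : `|dot (grid_point z) (e i)| <= L i.
    rewrite /L; case: ifP => im.
      have := pP (grid_point z) i; rewrite im => <-.
      by apply: le_trans (coord_le _ _) _; move: zA; rewrite /= inE.
    exact: le_trans (coord_le _ _) (enorm_grid_point z).
  rewrite ler_norml => /andP[? ?]; apply/andP; split; first lra.
  (* [k i] cells fill the closed interval exactly; the extra one makes the upper bound strict. *)
  have -> : (k i).+1%:R * h = 2 * L i + h; last by lra.
  rewrite -natr1 mulrDl mul1r /k /L /h; congr (_ + _).
  by case: ifP => _; rewrite ?mulnA !natrM ?natrX; field; rewrite gt_eqF.
have inj : {in A &, injective (fun z => f (grid_point z))}.
  move=> z z' zA zA' /fP fzz.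
  have {fzz} : dot (grid_point z - grid_point z') (grid_point z - grid_point z') < 1.
    apply: le_lt_trans (fzz _ _) _; [by exists z|by exists z'|].
    have -> : n%:R * h ^+ 2 = (4 * n%:R)^-1 by rewrite /h; field; rewrite gt_eqF.
    by rewrite invf_lt1 ?mulr_gt0 // -natrM ltr1n; lia.
  move=> zz; apply/ffunP => i; apply: val_inj; apply/eqP.
  have : `|(z i)%:R - (z' i)%:R| < 1 :> R.
    have := enorm_coord_le (grid_point z - grid_point z') i; rewrite !mxE => /le_lt_trans.
    by apply; rewrite -(@ltr_pXn2r _ 2) ?nnegrE ?enorm_ge0 // sqr_enorm expr1n.
  rewrite ltr_distl ltrBlDr !natr1 !ltr_nat !ltnS => /andP[z'z zz'].
  by rewrite eqn_leq zz' z'z.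
have := @leq_card_in _ _ _ _ inj; rewrite card_ord => /leq_trans; apply.
have -> : (\prod_i (k i).+1 = (4 * n).+1 ^ m * (4 * n ^ 2 * M).+1 ^ (n - m))%N.
  by rewrite -prod_lt_if subnKC //; apply: eq_bigr => i _; rewrite /k; case: ifP.
have le_expn a b j : (a <= b -> a ^ j <= b ^ j)%N.
  by case: j => // j ab; rewrite leq_exp2r.
apply: (@leq_trans ((5 * n ^ 2) ^ m * (5 * n ^ 2 * M) ^ (n - m))).
  by rewrite leq_mul // le_expn; nia.
by rewrite (expnMn _ M) mulnA -expnD subnKC.
Qed.

(* By invariance the probability only depends on [enorm x]; averaged over the grid
   points of [0, M)^n it is at most the largest proportion of them that a slab
   around an (n - m)-dimensional subspace can contain. *)
Lemma prob_small_proj_grid x (r : R) M : (0 < n)%N -> (0 < M)%N -> 0 < r ->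
  n%:R * M%:R * r <= enorm x ->
  prob x r <= ((5 * n ^ 2) ^ n)%:R / M%:R ^+ m.
Proof.
move=> n0 M0 r0 Mx.
(* By homogeneity the event for [z] at radius 1 is the event for [r *: z] at radius [r], and
   [r *: z] is no longer than [x]. *)
have xz (z : {ffun 'I_n -> 'I_M}) : prob x r <= prob (grid_point z) 1.
  have -> : prob (grid_point z) 1 = prob (r *: grid_point z) r.
    rewrite /prob; congr (fine (gamma _)); apply/seteqP; split => V;
    by rewrite /small_proj /= orthoprojZ enormZ gtr0_norm // ger_pMr.
  apply: prob_small_proj_le; rewrite enormZ gtr0_norm //; apply: le_trans Mx.
  by rewrite mulrC ler_wpM2r ?enorm_grid_point // ltW.
have W : \sum_(z : {ffun 'I_n -> 'I_M}) 1 * prob (grid_point z) 1 <=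
    ((5 * n ^ 2) ^ n * M ^ (n - m))%:R.
  apply: weighted_events_le => [z|z|V]; [exact: ler01|exact: measurable_small_proj|].
  have := grid_point_small_proj_card V n0 M0; rewrite -(ler_nat R); apply: le_trans.
  rewrite -sum1_card natr_sum [leRHS]big_mkcond /= ler_sum // => z _.
  rewrite mul1r indicE; case: ifPn => [_|zV]; first by rewrite lern1 leq_b1.
  by rewrite (_ : (_ \in _) = false) //; apply/negbTE; rewrite notin_setE; exact/negP.
have nM : (n = m + (n - m))%N by rewrite subnKC.
have Mn : prob x r * M%:R ^+ n <= ((5 * n ^ 2) ^ n * M ^ (n - m))%:R.
  apply: le_trans W; apply: (@le_trans _ _ (\sum_(z : {ffun 'I_n -> 'I_M}) prob x r)).
    by rewrite sumr_const card_ffun !card_ord -natrX mulr_natr.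
  by apply: ler_sum => z _; rewrite mul1r.
rewrite ler_pdivlMr ?exprn_gt0 ?ltr0n //.
rewrite -(@ler_pM2r _ (M%:R ^+ (n - m))) ?exprn_gt0 ?ltr0n //.
by rewrite -mulrA -exprD -nM -natrX -natrM.
Qed.

(** The grid bound is applied with the largest admissible [M], the integer part of [q]. If [q < 1]
    the right-hand side already exceeds 1. *)
Lemma transversality : (0 < n)%N -> exists2 C : R, 0 < C &
  forall x r, x != 0 -> 0 < r -> prob x r <= C * (r / enorm x) ^+ m.
Proof.
move=> n0; have n0' : 0 < n%:R :> R by rewrite ltr0n.
have D1 : 1 <= ((5 * n ^ 2) ^ n)%:R :> R.
  by rewrite ler1n expn_gt0 muln_gt0 expn_gt0 n0.
exists (((5 * n ^ 2) ^ n)%:R * (2 * n%:R) ^+ m).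
  by rewrite mulr_gt0 ?exprn_gt0 ?mulr_gt0 // (lt_le_trans ltr01).
move=> x r x0 r0; have ex := enorm_gt0 x0.
rewrite -mulrA -exprMn.
pose q := enorm x / (n%:R * r); have q0 : 0 < q by rewrite divr_gt0 // mulr_gt0.
have -> : 2 * n%:R * (r / enorm x) = 2 / q.
  by rewrite /q; field; rewrite !gt_eqF.
have [q1|q1] := ltP q 1.
  apply: (@le_trans _ _ 1).
    rewrite -lee_fin fineK ?fin_num_measure ?probability_le1 //;
    exact: measurable_small_proj.
  rewrite mulr_ege1 // exprn_ege1 // ler_pdivlMr // mul1r.
  by rewrite (le_trans (ltW q1)) // ler1n.
pose M := Num.truncn q.
have M0 : (0 < M)%N by rewrite truncn_gt0.
have /andP[Mq qM] := truncn_itv (ltW q0); rewrite -/M in Mq qM.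
apply: le_trans (prob_small_proj_grid n0 M0 r0 _) _.
  by move: Mq; rewrite /q ler_pdivlMr ?mulr_gt0 // mulrCA mulrA.
rewrite ler_pM2l ?(lt_le_trans ltr01) // -exprVn lerXn2r ?nnegrE ?invr_ge0 ?ler0n //.
  by rewrite divr_ge0 // ltW.
(* Rounding costs at most a factor 2: [M >= q / 2] because [M >= 1]. *)
have q20 : 0 < q / 2 by rewrite divr_gt0.
rewrite -invf_div lef_pV2 ?posrE ?ltr0n //.
rewrite ler_pdivrMr // mulr_natr; apply: le_trans (ltW qM) _.
by rewrite -natr1 mulr2n lerD2l ler1n.
Qed.

End Transversality.

(** * A finite Frostman lemma *)

Lemma lab_coarser (T L : Type) (lab : nat -> T -> L) :
  (forall j x y, lab j.+1 x = lab j.+1 y -> lab j x = lab j y) ->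
  forall j l x y, (j <= l)%N -> lab l x = lab l y -> lab j x = lab j y.
Proof. by move=> labS j l x y /subnK <-; elim: (l - j)%N => // i IH /labS. Qed.

Section FlowOnTree.
Variables (R : realFieldType) (T : finType) (L : eqType) (lab : nat -> T -> L).
Variables (k : nat) (a : nat -> R).
Hypotheses (a0 : forall j, 0 < a j)
  (labS : forall j x y, lab j.+1 x = lab j.+1 y -> lab j x = lab j y)
  (lab_inj : injective (lab k)).

(** The elements of [T] are the leaves, [lab j x] is the cell of level [j] containing [x], and [a j]
    is the capacity of the cells of that level. *)
Definition mass (w : T -> R) j x := \sum_(y | lab j y == lab j x) w y.

Lemma mass_eq w j x y : lab j x = lab j y -> mass w j x = mass w j y.
Proof. by rewrite /mass => ->. Qed.

(* [J x] is the level of a cell around [x] which is filled to capacity. *)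
Definition saturated_from j (w : T -> R) (J : T -> nat) := [/\
  forall x, 0 <= w x,
  forall x, (j <= J x <= k)%N,
  forall l x, (j <= l <= k)%N -> mass w l x <= a l,
  forall x, mass w (J x) x = a (J x) &
  forall x y, lab (J x) y = lab (J x) x -> J y = J x].

(** Overfull cells of level [j] are scaled down to capacity and become the saturated cells of their
    leaves. Other cells are left alone with their saturated descendants. As the factors are at most
    1, finer capacities stay respected. *)
Lemma saturated_step j : (j < k)%N ->
  (exists w J, saturated_from j.+1 w J) -> exists w J, saturated_from j w J.
Proof.
move=> jk [w [J [w0 Jk wa wJ JJ]]].
pose over x := a j < mass w j x.
have overE x y : lab j x = lab j y -> over x = over y.
  by move=> xy; rewrite /over (mass_eq _ xy).
pose c x := if over x then a j / mass w j x else 1.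
have c0 x : 0 <= c x.
  rewrite /c; case: ifP => // ox; rewrite divr_ge0 ?ltW //.
  exact: lt_trans ox.
have c1 x : c x <= 1.
  rewrite /c; case: ifP => // ox; rewrite ler_pdivrMr ?mul1r ?ltW //.
  exact: lt_trans ox.
have cE x y : lab j x = lab j y -> c x = c y.
  by move=> xy; rewrite /c (overE _ _ xy) (mass_eq _ xy).
have massc l x : (j <= l)%N -> mass (fun y => c y * w y) l x = c x * mass w l x.
  move=> jl; rewrite /mass mulr_sumr; apply: eq_bigr => y /eqP yx.
  by rewrite (cE y x) //; exact: (lab_coarser labS) yx.
exists (fun y => c y * w y), (fun x => if over x then j else J x); split.
- by move=> x; rewrite mulr_ge0.
- move=> x; case: ifP => _; first by rewrite leqnn ltnW.
  by have /andP[/ltnW -> ->] := Jk x.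
- move=> l x /andP[jl lk]; rewrite massc //.
  have m0 : 0 <= mass w l x by apply: sumr_ge0.
  have [{m0}/eqP lj|lj] := boolP (l == j); last first.
    apply: le_trans (wa l x _); first by rewrite ler_piMl.
    by rewrite lk andbT ltn_neqAle eq_sym lj.
  rewrite lj /c; case: ifP => [ox|]; first by rewrite divfK // gt_eqF // (lt_trans _ ox).
  by rewrite mul1r /over; case: ltP.
- move=> x; case: ifP => ox; rewrite massc //.
    by rewrite /c ox divfK // gt_eqF // (lt_trans _ ox).
    by rewrite /c ox mul1r wJ.
  by have /andP[/ltnW] := Jk x.
- move=> x y; case: (ifP (over x)) => ox yx; first by rewrite (overE _ _ yx) ox.
  have -> : over y = over x.
    by apply: overE; apply: (lab_coarser labS) yx; have /andP[/ltnW] := Jk x.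
  by rewrite ox; exact: JJ.
Qed.

(** The induction starts at level [k], where every cell is a single leaf and is filled to capacity,
    and moves up to level 0. *)
Lemma saturated_all : exists w J, saturated_from 0 w J.
Proof.
suff H i : (i <= k)%N -> exists w J, saturated_from (k - i) w J.
  by have := H k (leqnn k); rewrite subnn.
elim: i => [_|i IH ik]; last first.
  apply: saturated_step; first by rewrite subnSK // leq_subr.
  by rewrite subnSK //; apply: IH; exact: ltnW.
have mk x : mass (fun=> a k) k x = a k.
  rewrite /mass (eq_bigl (pred1 x)) ?big_pred1_eq // => y.
  by rewrite /= (inj_eq lab_inj).
rewrite subn0; exists (fun=> a k), (fun=> k); split => //.
- by move=> x; exact: ltW.
- by move=> x; rewrite leqnn.
- by move=> l x; rewrite -eqn_leq => /eqP <-; rewrite mk.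
Qed.

(** The saturated cells partition the leaves. With [Z] containing one leaf of each, they form a cut
    whose total capacity is the total flow. *)
Lemma max_flow_min_cut : exists (w : T -> R) (J : T -> nat) (Z : {set T}),
  [/\ forall x, 0 <= w x,
      forall x, (J x <= k)%N,
      forall l x, (l <= k)%N -> mass w l x <= a l,
      forall x, exists2 z, z \in Z & lab (J z) x = lab (J z) z &
      \sum_x w x = \sum_(z in Z) a (J z)].
Proof.
have [w [J [w0 Jk wa wJ JJ]]] := saturated_all.
pose eqv x y := lab (J x) y == lab (J x) x.
(* A canonical leaf of the saturated cell of [x]: [pick] depends only on the cell, and its default
   never occurs since [x] lies in its own cell. *)
pose r x := odflt x [pick y | eqv x y].
have rx x : lab (J x) (r x) = lab (J x) x.
  by rewrite /r; case: pickP => [y /eqP|/(_ x)]; rewrite /eqv //= eqxx.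
have eqvE x y : lab (J x) y = lab (J x) x -> r y = r x.
  move=> yx; have Jxy := JJ _ _ yx; rewrite /r.
  have -> : [pick z | eqv y z] = [pick z | eqv x z].
    by apply: eq_pick => z; rewrite /eqv Jxy yx.
  by case: pickP => [//|/(_ x)]; rewrite /eqv eqxx.
have rr x : r (r x) = r x by apply: eqvE; exact: rx.
exists w, J, [set z | r z == z]%SET; split => //.
- move=> x; exists (r x); first by rewrite inE rr.
  by rewrite (JJ _ _ (rx x)) rx.
- rewrite (partition_big r (fun z => r z == z)) /=; last by move=> x _; rewrite rr.
  apply: eq_big => [z|z /eqP rz]; first by rewrite inE.
  rewrite -wJ /mass; apply: eq_bigl => x; apply/eqP/eqP => [<-|/eqvE ->//].
  by rewrite (JJ _ _ (rx x)) rx.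
Qed.

End FlowOnTree.

Lemma finite_representatives (X : Type) (L : eqType) (f : X -> L) (A : set X) :
  finite_set (f @` A) -> exists N (pt : 'I_N -> X),
    [/\ forall i, A (pt i), injective (f \o pt) &
        forall x : X, A x -> exists i, f (pt i) = f x].
Proof.
move=> /finite_seqP[s fA]; pose t := undup s.
have tE (i : 'I_(size t)) : exists x : X, A x /\ f x = tnth (in_tuple t) i.
  have : [set` s] (tnth (in_tuple t) i) by rewrite /= -mem_undup mem_tnth.
  by rewrite -fA => -[x Ax <-]; exists x.
have [pt ptP] := choice tE; exists (size t), pt; split.
- by move=> i; case: (ptP i).
- move=> i j /=; rewrite (ptP i).2 (ptP j).2 !(tnth_nth (f (pt i))) /= => /eqP.
  by rewrite nth_uniq ?undup_uniq // => /eqP; exact: val_inj.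
- move=> x Ax; have : [set` s] (f x) by rewrite -fA; exists x.
  rewrite /= -mem_undup -/t => xt; have := xt; rewrite -index_mem => it.
  by exists (Ordinal it); rewrite (ptP _).2 (tnth_nth (f x)) /= nth_index.
Qed.

(** * Dyadic cells *)

Section Frostman.
Variables (R : realType) (n : nat).
Implicit Types (x y : 'rV[R]_n) (E : set 'rV[R]_n).

Definition cell (j : nat) x : {ffun 'I_n -> int} :=
  [ffun i => Num.floor (2 ^+ j * x 0 i)].

(** Cells are nested because the floor of [u] is the integer half of the floor of [2 * u]. *)
Lemma cellS j x y : cell j.+1 x = cell j.+1 y -> cell j x = cell j y.
Proof.
move=> /ffunP xy; apply/ffunP => i; have := xy i; rewrite !ffunE.
have fl (u : R) : Num.floor u = (Num.floor (2 * u) %/ 2)%Z.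
  apply: floor_def; have := floor_itv (2 * u).
  set q := Num.floor (2 * u) => /andP[qu uq].
  have := divz_eq q 2; have := modz_ge0 q (isT : 2%Z != 0); have := ltz_pmod q (isT : 0 < 2%Z).
  move: (q %/ 2)%Z (q %% 2)%Z => a b b2 b0 qE; move: qu uq; rewrite qE.
  rewrite !intrD !intrM /=.
  have b0' : 0 <= b%:~R :> R by rewrite ler0z.
  have b1' : b%:~R <= 1%:~R :> R by rewrite ler_int; lia.
  by move=> *; apply/andP; split; lra.
by rewrite !exprS -!(mulrA 2) => e; rewrite (fl (_ * x 0 i)) e -fl.
Qed.

Lemma enorm_cell_le j x y : cell j x = cell j y -> enorm (x - y) <= n%:R * 2^-1 ^+ j.
Proof.
move=> /ffunP xy; have h0 : 0 < 2^-1 ^+ j :> R by rewrite exprn_gt0 // invr_gt0.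
rewrite enorm_le ?mulr_ge0 ?(ltW h0) // /dot.
apply: (@le_trans _ _ (\sum_(i < n) (2^-1 ^+ j) ^+ 2)).
  apply: ler_sum => i _; rewrite !mxE -expr2.
  rewrite -[leLHS]real_normK ?num_real // ler_pXn2r ?nnegrE ?(ltW h0) //.
  have := xy i; rewrite !ffunE; move: (floor_itv (2 ^+ j * x 0 i)) (floor_itv (2 ^+ j * y 0 i)).
  move=> /andP[x1 x2] /andP[y1 y2] f; rewrite -f in y1 y2; move: x1 x2 y1 y2.
  move: (Num.floor _) => q; rewrite intrD => x1 x2 y1 y2.
  have e0 : 0 < 2 ^+ j :> R by rewrite exprn_gt0.
  rewrite exprVn -[leRHS]div1r ler_pdivlMr // -[X in _ * X]gtr0_norm // -normrM.
  by rewrite mulrBl ler_norml; apply/andP; split; lra.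
rewrite sumr_const card_ord exprMn -[_ *+ n]mulr_natl ler_wpM2r ?sqr_ge0 //.
by rewrite -natrX ler_nat; case: (n) => // k; rewrite expnS expn1 leq_pmulr.
Qed.

Lemma bounded_coord E : bounded_set E ->
  exists2 B : R, 0 < B & forall x, E x -> forall i, `|x 0 i| <= B.
Proof.
move=> [M [_ MP]]; exists (`|M| + 1); first by rewrite ltr_pwDr.
move=> x Ex i; apply: le_trans (MP (`|M| + 1) _ x Ex); last first.
  by rewrite (le_lt_trans (ler_norm M)) // ltrDl.
rewrite [leRHS]mx_normrE; exact: (le_bigmax _ (fun ij => `|x ij.1 ij.2|) (0, i)).
Qed.

Lemma finite_cells E j : bounded_set E -> finite_set (cell j @` E).
Proof.
move=> /bounded_coord[B B0 EB]; pose K := (Num.truncn (2 ^+ j * B)).+1.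
(* All indices lie between [-K] and [K]; shifting by [K] makes them ordinals. *)
pose g (c : {ffun 'I_n -> 'I_(2 * K).+1}) : {ffun 'I_n -> int} :=
  [ffun i => (c i)%:Z - K%:Z].
apply: (@sub_finite_set _ _ (g @` setT)); last exact/finite_image/finite_finset.
move=> _ [x Ex <-]; exists [ffun i => inord (absz (cell j x i + K%:Z)%R)] => //.
apply/ffunP => i; rewrite !ffunE.
have xB : `|2 ^+ j * x 0 i| <= 2 ^+ j * B.
  by rewrite normrM ger0_norm ?exprn_ge0 // ler_wpM2l ?exprn_ge0 // EB.
have /andP[_ BK] : (Num.truncn (2 ^+ j * B))%:R <= 2 ^+ j * B < K%:R.
  by rewrite truncn_itv // mulr_ge0 ?exprn_ge0 // ltW.
move: xB; rewrite ler_norml => /andP[xl xu].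
have fl : - K%:Z <= Num.floor (2 ^+ j * x 0 i).
  by rewrite floor_ge_int rmorphN /=; apply: le_trans xl; rewrite lerN2 ltW.
have fu : Num.floor (2 ^+ j * x 0 i) <= K%:Z.
  rewrite -ltzD1 floor_lt_int intrD; apply: le_lt_trans xu _.
  by apply: lt_trans BK _; rewrite ltrDl.
by rewrite inordK; lia.
Qed.

End Frostman.

Section HausdorffContent.
Variables (R : realType) (n : nat).
Implicit Types (x y : 'rV[R]_n) (E : set 'rV[R]_n) (s delta : R).

Lemma hausdorff_content_ge0 s delta E : (0 <= hausdorff_content s delta E)%E.
Proof.
apply: le_ereal_inf_tmp => _ [D [U [_ _ ->]]].
by apply: esum_ge0 => i _; exact: poweR_ge0.
Qed.

Lemma hausdorff_content_le s delta E (I : finType) (Z : {set I})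
    (U : I -> set 'rV[R]_n) :
  (forall x, E x -> exists2 z, z \in Z & U z x) ->
  (forall z, z \in Z -> (diam (U z) <= delta%:E)%E) ->
  (hausdorff_content s delta E <= \sum_(z in Z) diam (U z) `^ s)%E.
Proof.
move=> EU Ud; set S := map U (enum Z).
have -> : (\sum_(z in Z) diam (U z) `^ s =
    \esum_(i in `I_(size S)) diam (nth set0 S i) `^ s)%E.
  rewrite esum_fset //; last by move=> i _; exact: poweR_ge0.
  rewrite -fsbig_ord -(big_mkord xpredT (fun i => diam (nth set0 S i) `^ s)%E).
  by rewrite -(big_nth set0 xpredT (fun V => diam V `^ s)%E) big_map big_enum.
apply: ereal_inf_lbound; exists `I_(size S), (nth set0 S); split => //.
  move=> x /EU[z zZ Uzx]; exists (index z (enum Z)).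
    by rewrite /= size_map index_mem mem_enum.
  by rewrite (nth_map z) ?index_mem ?mem_enum // nth_index // mem_enum.
move=> i /= iS; have : nth set0 S i \in S by rewrite mem_nth.
by move=> /mapP[z]; rewrite mem_enum => zZ ->; exact: Ud.
Qed.

Lemma hausdorff_measure_neq0 s E : hausdorff_measure s E != 0%E ->
  exists delta c : R, [/\ 0 < delta, 0 < c & (c%:E <= hausdorff_content s delta E)%E].
Proof.
move=> H0; have [delta d0 cd] : exists2 delta, 0 < delta &
    (0 < hausdorff_content s delta E)%E.
  apply: contrapT => H; move/eqP: H0; apply; apply/eqP; rewrite eq_le.
  apply/andP; split; last first.
    apply: le_trans (hausdorff_content_ge0 s 1 E) _.
    by apply: ereal_sup_ubound; exists 1 => //=.
  apply: ge_ereal_sup => _ [delta /= d0 <-]; rewrite leNgt; apply/negP => cd.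
  by apply: H; exists delta.
case cE : (hausdorff_content s delta E) cd => [c||//].
  by rewrite lte_fin => c0; exists delta, c; rewrite cE.
(* Infinite content: any positive constant is a lower bound. *)
by move=> _; exists delta, 1; rewrite cE leey.
Qed.

(* A finite form of Frostman's lemma: on the tree of dyadic cells of levels
   [0 .. k], the minimal cut is a cover of [E], hence costs at least a constant
   times its Hausdorff content, uniformly in [k]. *)
Lemma discrete_frostman s E : (0 < n)%N -> bounded_set E -> 0 < s ->
  hausdorff_measure s E != 0%E ->
  exists2 C : R, 0 < C & forall k : nat,
    exists N (p : 'I_N -> R) (pt : 'I_N -> 'rV[R]_n),
    [/\ forall i, 0 <= p i, forall i, E (pt i), \sum_i p i = 1 &
        forall j i, (j <= k)%N ->
          \sum_(i' | cell j (pt i') == cell j (pt i)) p i' <= C * (2^-1 `^ s) ^+ j].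
Proof.
move=> n0 Eb s0 /hausdorff_measure_neq0[delta [c [d0 c0 cE]]].
have n0' : 0 < n%:R :> R by rewrite ltr0n.
set beta := 2^-1 `^ s; have b0 : 0 < beta by rewrite powR_gt0 // invr_gt0.
have sideE j : (n%:R * 2^-1 ^+ j) `^ s = n%:R `^ s * beta ^+ j.
  have q0 : 0 <= 2^-1 :> R by rewrite invr_ge0.
  rewrite powRM ?exprn_ge0 // -(powR_mulrn j q0) powRAC.
  by rewrite powR_mulrn ?powR_ge0.
have ns0 : 0 < n%:R `^ s by rewrite powR_gt0.
(* If some cell of the cut has side bound above [delta], its capacity alone gives the second term.
   Otherwise the cut is an admissible cover in [hausdorff_content s delta E], which gives the
   first. *)
pose c' := Num.min (c / n%:R `^ s) (delta `^ s / n%:R `^ s).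
have c'0 : 0 < c' by rewrite lt_min !divr_gt0 // powR_gt0.
exists c'^-1; first by rewrite invr_gt0.
(* The leaves are points of [E], one for each cell of level [k] that meets [E]. *)
move=> k; have [N [pt [ptE ptinj ptP]]] := finite_representatives (finite_cells k Eb).
have [w [J [Z [w0 Jk wa JZ wE]]]] := @max_flow_min_cut R 'I_N _
  (fun j i => cell j (pt i)) k (fun j => beta ^+ j) (fun j => exprn_gt0 j b0)
  (fun j i i' => @cellS R n j (pt i) (pt i')) ptinj.
set W := \sum_i w i in wE.
have WZ z : z \in Z -> beta ^+ J z <= W.
  move=> zZ; rewrite wE (bigD1 z) //= lerDl sumr_ge0 // => i _.
  by rewrite exprn_ge0 // ltW.
have cW : c' <= W.
  have [/existsP[z /andP[zZ dz]]|H] :=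
      boolP [exists z, (z \in Z) && (delta < n%:R * 2^-1 ^+ J z)].
    apply: le_trans (WZ z zZ); rewrite ge_min; apply/orP; right.
    rewrite ler_pdivrMr // mulrC -sideE; apply: ge0_ler_powR (ltW dz); first exact: ltW.
      by rewrite nnegrE ltW.
    by rewrite nnegrE ltW // (lt_trans d0).
  pose U (z : 'I_N) := [set x | E x /\ cell (J z) x = cell (J z) (pt z)].
  have Ud z : (diam (U z) <= (n%:R * 2^-1 ^+ J z)%:E)%E.
    apply/diam_leP; first by rewrite mulr_ge0 ?exprn_ge0 ?invr_ge0.
    by move=> x y [_ xz] [_ yz]; apply: enorm_cell_le; rewrite xz yz.
  have EU x : E x -> exists2 z, z \in Z & U z x.
    move=> Ex; have [i ix] := ptP x Ex; have [z zZ zi] := JZ i.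
    exists z => //; split => //; rewrite -zi.
    by apply: (lab_coarser (@cellS R n)) (Jk z) _.
  have Es : forall z, z \in Z -> (diam (U z) <= delta%:E)%E.
    move=> z zZ; apply: le_trans (Ud z) _; rewrite lee_fin.
    by move/existsPn/(_ z): H; rewrite zZ -leNgt.
  have := le_trans cE (hausdorff_content_le s EU Es).
  have Us : (\sum_(z in Z) diam (U z) `^ s <= (n%:R `^ s * W)%:E)%E.
    rewrite wE mulr_sumr -sumEFin; apply: lee_sum => z _.
    rewrite -sideE -poweR_EFin; apply: gt0_ler_poweR => //; first exact: ltW.
      by rewrite in_itv /= diam_ge0 leey.
    by rewrite in_itv /= leey andbT lee_fin mulr_ge0 ?exprn_ge0 ?invr_ge0.
  move=> /le_trans /(_ Us); rewrite lee_fin => cW.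
  by rewrite ge_min ler_pdivrMr // mulrC cW.
have W0 : 0 < W := lt_le_trans c'0 cW.
exists N, (fun i => w i / W), pt; split => //.
- by move=> i; rewrite divr_ge0 // ltW.
- by rewrite -mulr_suml divff // gt_eqF.
move=> j i jk; rewrite -mulr_suml ler_pdivrMr // mulrAC.
apply: le_trans (wa j i jk) _; rewrite ler_peMl ?exprn_ge0 ?(ltW b0) //.
by rewrite mulrC ler_pdivlMr // mul1r.
Qed.

End HausdorffContent.

(** * Energy of projections *)

Section Energy.
Variables (R : realType) (n m : nat) (hmn : (m <= n)%N).
Variable gamma : probability (borel_grassmannian R hmn) R.
Hypothesis hgamma : rotation_invariant gamma.
Hypothesis n0 : (0 < n)%N.
Implicit Types (x y : 'rV[R]_n) (E : set 'rV[R]_n).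

Let prob x r : R := fine (gamma (small_proj hmn x r)).

Let prob_le1 x r : prob x r <= 1.
Proof.
by rewrite -lee_fin fineK ?fin_num_measure ?probability_le1 //;
  exact: measurable_small_proj.
Qed.

(* A ball of radius [2^-j] meets at most [3^n] cells of level [j]. *)
Lemma ball_mass N (p : 'I_N -> R) (pt : 'I_N -> 'rV[R]_n) j (b : R) :
  (forall i, 0 <= p i) -> 0 <= b ->
  (forall i, \sum_(i' | cell j (pt i') == cell j (pt i)) p i' <= b) ->
  forall x, \sum_(i | enorm (x - pt i) < 2^-1 ^+ j) p i <= (3 ^ n)%:R * b.
Proof.
move=> p0 b0 pb x.
(* In each direction the cell of [pt i] is offset by -1, 0 or 1 from that of [x]; adding 1 encodes
   the offset in ['I_3]. *)
pose t i : {ffun 'I_n -> 'I_3} :=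
  [ffun l => inord (absz (cell j (pt i) l - cell j x l + 1))].
have tP i : enorm (x - pt i) < 2^-1 ^+ j ->
    forall l, (t i l)%:Z = cell j (pt i) l - cell j x l + 1.
  move=> xi l; rewrite ffunE.
  have e0 : 0 < 2 ^+ j :> R by rewrite exprn_gt0.
  have : `|2 ^+ j * x 0 l - 2 ^+ j * pt i 0 l| < 1.
    rewrite -mulrBr normrM gtr0_norm // -ltr_pdivlMl // mulr1 -exprVn.
    by apply: le_lt_trans xi; have := enorm_coord_le (x - pt i) l; rewrite !mxE.
  rewrite !ffunE; move: (floor_itv (2 ^+ j * x 0 l)) (floor_itv (2 ^+ j * pt i 0 l)).
  move: (Num.floor _) (Num.floor _) => a a' /andP[a1 a2] /andP[a'1 a'2].
  rewrite ltr_norml => /andP[l1 l2]; rewrite !intrD in a2 a'2.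
  have u1 : a' - a < 2.
    by rewrite -(ltr_int R) intrB; lra.
  have u2 : - 2%:Z < a' - a.
    by rewrite -(ltr_int R) intrB intrN; lra.
  by rewrite inordK; lia.
rewrite (partition_big t xpredT) //=.
apply: (@le_trans _ _ (\sum_(c : {ffun 'I_n -> 'I_3}) b)); last first.
  by rewrite sumr_const card_ffun !card_ord mulr_natl.
apply: ler_sum => c _.
have [i /andP[xi /eqP ti]|H] :=
    pickP (fun i => (enorm (x - pt i) < 2^-1 ^+ j) && (t i == c)); last first.
  by rewrite big_pred0.
apply: le_trans (pb i); rewrite [leRHS](bigID (fun i => (enorm (x - pt i) < 2^-1 ^+ j) && (t i == c))) /=.
rewrite (eq_bigl (fun i' => (cell j (pt i') == cell j (pt i)) &&
    ((enorm (x - pt i') < 2^-1 ^+ j) && (t i' == c)))).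
  by rewrite lerDl sumr_ge0.
move=> i'; have [/andP[xi' /eqP ti']|_] := boolP (_ && (t i' == c)); last by rewrite andbF.
rewrite andbT; apply/esym/eqP/ffunP => l.
have := tP i xi l; have := tP i' xi' l; rewrite ti ti' => ->.
by move=> /addIr/addIr ->.
Qed.

Lemma dyadic_scale k (y : R) : 2^-1 ^+ k <= y -> y < 1 ->
  exists2 j, (j < k)%N & 2^-1 ^+ j.+1 <= y /\ y < 2^-1 ^+ j.
Proof.
elim: k => [|k IH] ky y1; first by move: ky; rewrite expr0 leNgt y1.
have [yk|/IH] := ltP y (2^-1 ^+ k); first by exists k.
by case=> // j jk jy; exists j => //; exact: ltnW.
Qed.

(** The transversality bound [(2^-k / |x|)^m] is majorised by a sum of indicators of dyadic balls,
    so that averaging it against a measure involves only masses of balls. *)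
Lemma prob_le_dyadic : exists2 D : R, 0 < D & forall k x,
  prob x (2^-1 ^+ k) <= D * (2^-1 ^+ k) ^+ m *
    (1 + \sum_(j < k.+1) (2 ^+ m) ^+ j * (enorm x < 2^-1 ^+ j)%R%:R).
Proof.
have [C C0 tr] := transversality hgamma n0.
have m0 : 0 < 2 ^+ m :> R by rewrite exprn_gt0.
have m1 : 1 <= 2 ^+ m :> R by rewrite exprn_ege1 // ler1n.
exists (1 + C * 2 ^+ m); first by rewrite addr_gt0 // mulr_gt0.
set D := 1 + _; have D1 : 1 <= D by rewrite lerDl mulr_ge0 // ltW.
have D0 : 0 < D by exact: lt_le_trans D1.
move=> k x; set h := 2^-1 ^+ k; have h0 : 0 < h by rewrite exprn_gt0 // invr_gt0.
set S := \sum_(j < _) _.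
have term (j : 'I_k.+1) : (2 ^+ m) ^+ j * (enorm x < 2^-1 ^+ j)%R%:R <= S.
  by rewrite /S (bigD1 j) //= lerDl sumr_ge0.
have S0 : 0 <= S by apply: le_trans (term ord0); rewrite mulr_ge0 // ltW.
have hm0 : 0 < h ^+ m by rewrite exprn_gt0.
(* Three ranges: below [2^-k] the term [j = k] dominates the trivial bound 1; above 1 the constant
   term suffices; in between the term of the dyadic scale of [|x|] does. *)
have [xk|xk] := ltP (enorm x) h.
  apply: le_trans (prob_le1 _ _) _.
  have := term ord_max; rewrite /= xk mulr1 => Sk.
  have hk : h ^+ m * (2 ^+ m) ^+ k = 1.
    by rewrite /h -!exprM mulnC -exprMn mulVf ?expr1n.
  rewrite -mulrA mulr_ege1 // -[leLHS]hk ler_pM2l //; apply: le_trans Sk _.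
  by rewrite lerDr ler01.
have ex : 0 < enorm x by exact: lt_le_trans xk.
have x0 : x != 0 by apply: contraTneq ex => ->; rewrite enorm0 ltxx.
apply: le_trans (tr x h x0 h0) _.
have CD : C * 2 ^+ m <= D by rewrite lerDr.
have [x1|x1] := leP 1 (enorm x).
  apply: (@le_trans _ _ (D * h ^+ m)).
    rewrite ler_pM ?exprn_ge0 ?divr_ge0 ?(ltW h0) ?(ltW C0) ?enorm_ge0 //.
      by apply: le_trans CD; rewrite ler_peMr // ltW.
    rewrite lerXn2r ?nnegrE ?divr_ge0 ?(ltW h0) ?enorm_ge0 //.
    by rewrite ler_pdivrMr // ler_peMr // ltW.
  by rewrite ler_peMr ?lerDl // mulr_ge0 // ltW.
have [j jk [xj jx]] := dyadic_scale xk x1.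
have := term (widen_ord (leqnSn k) (Ordinal jk)); rewrite /= jx mulr1 => Sj.
apply: (@le_trans _ _ (D * h ^+ m * (2 ^+ m) ^+ j)); last first.
  rewrite ler_pM2l ?mulr_gt0 //; apply: le_trans Sj _.
  by rewrite lerDr ler01.
apply: (@le_trans _ _ (C * (h * 2 ^+ j.+1) ^+ m)).
  rewrite ler_pM2l // lerXn2r ?nnegrE ?divr_ge0 ?mulr_ge0 ?exprn_ge0 ?(ltW h0) ?enorm_ge0 //.
  rewrite ler_pM2l // -[leRHS]invrK lef_pV2 ?posrE ?invr_gt0 ?exprn_gt0 //.
  by rewrite -exprVn.
have -> : C * (h * 2 ^+ j.+1) ^+ m = C * 2 ^+ m * (h ^+ m * (2 ^+ m) ^+ j).
  by rewrite exprMn exprS exprMn [2 ^+ j ^+ m]exprAC; ring.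
by rewrite -[leRHS]mulrA ler_wpM2r // ltW // mulr_gt0 // exprn_gt0.
Qed.

(* Summed over the dyadic scales, the mass bound [b beta ^ j] makes a geometric
   series of ratio [2 ^ m * beta > 1], dominated by its last term. *)
Lemma energy_le (beta b : R) : 1 < 2 ^+ m * beta -> 0 < beta -> 0 <= b ->
  exists2 C : R, 0 < C & forall k N (p : 'I_N -> R) (pt : 'I_N -> 'rV[R]_n),
    (forall i, 0 <= p i) -> \sum_i p i = 1 ->
    (forall j i, (j <= k)%N ->
      \sum_(i' | cell j (pt i') == cell j (pt i)) p i' <= b * beta ^+ j) ->
    \sum_i \sum_i' p i * p i' * prob (pt i - pt i') (2^-1 ^+ k) <= C * beta ^+ k.
Proof.
move=> q1 beta0 b0; have [D D0 DP] := prob_le_dyadic.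
move: q1; move qE : (2 ^+ m * beta) => q q1.
have q10 : 0 < q - 1 by rewrite subr_gt0.
have q0 : 0 < q by exact: lt_trans q1.
have qq0 : 0 <= q / (q - 1) by rewrite divr_ge0 // ltW.
exists (D * (1 + (3 ^ n)%:R * b * (q / (q - 1)))).
  by rewrite mulr_gt0 // ltr_pwDl // mulr_ge0 // mulr_ge0.
move=> k N p pt p0 p1 pb; set h := 2^-1 ^+ k.
have h0 : 0 < h by rewrite exprn_gt0 // invr_gt0.
have hm0 : 0 < D * h ^+ m by rewrite mulr_gt0 // exprn_gt0.
have geo : \sum_(j < k.+1) q ^+ j <= q / (q - 1) * q ^+ k.
  rewrite mulrAC ler_pdivlMr // mulrC -subrX1 exprS lerBlDr lerDl ler01 //.
(* The prefactor [h ^+ m] turns the dominant term of the series back into [beta ^+ k]. *)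
have hq : h ^+ m * q ^+ k = beta ^+ k.
  by rewrite /h -qE exprMn -!exprM mulrA mulnC -exprMn mulVf // expr1n mul1r.
have inner i : \sum_i' p i' * prob (pt i - pt i') h <=
    D * (1 + (3 ^ n)%:R * b * (q / (q - 1))) * beta ^+ k.
  apply: (@le_trans _ _ (\sum_i' p i' * (D * h ^+ m * (1 +
      \sum_(j < k.+1) (2 ^+ m) ^+ j * (enorm (pt i - pt i') < 2^-1 ^+ j)%R%:R)))).
    by apply: ler_sum => i' _; rewrite ler_wpM2l // DP.
  under eq_bigr do rewrite mulrCA mulrDr mulr1.
  have -> : D * (1 + (3 ^ n)%:R * b * (q / (q - 1))) * beta ^+ k =
      D * h ^+ m * ((1 + (3 ^ n)%:R * b * (q / (q - 1))) * q ^+ k).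
    by rewrite -hq; ring.
  rewrite -mulr_sumr ler_pM2l //.
  rewrite big_split /= p1.
  under eq_bigr do rewrite mulr_sumr.
  rewrite exchange_big /=.
  apply: (@le_trans _ _ (1 + \sum_(j < k.+1) (3 ^ n)%:R * b * q ^+ j)).
    rewrite lerD2l; apply: ler_sum => j _.
    under eq_bigr do rewrite mulrCA.
    rewrite -mulr_sumr -qE exprMn [leRHS]mulrCA ler_pM2l ?exprn_gt0 //.
    have bj0 : 0 <= b * beta ^+ j by rewrite mulr_ge0 // exprn_ge0 // ltW.
    have := ball_mass p0 bj0 (fun i => pb j i (ltn_ord j)) (pt i).
    rewrite mulrA; apply: le_trans; rewrite [leRHS]big_mkcond /=.
    by apply: ler_sum => i' _; case: ifP; rewrite ?mulr1 ?mulr0.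
  rewrite mulrDl mul1r lerD ?exprn_ege1 ?(ltW q1) //.
  by rewrite -mulr_sumr -[leRHS]mulrA ler_wpM2l // mulr_ge0.
apply: (@le_trans _ _ (\sum_i p i * (D * (1 + (3 ^ n)%:R * b * (q / (q - 1))) * beta ^+ k))).
  apply: ler_sum => i _; apply: le_trans (ler_wpM2l (p0 i) (inner i)).
  by rewrite mulr_sumr; under [leRHS]eq_bigr do rewrite mulrA.
by rewrite -mulr_suml p1 mul1r.
Qed.

(* Cauchy-Schwarz: a cover by [K] sets of diameter at most [r] carries at least
   [1 / K] of the [p * p]-mass on pairs of points at distance at most [r]. *)
Lemma coverable_energy (V : grassmannian R hmn) E N (p : 'I_N -> R)
    (pt : 'I_N -> 'rV[R]_n) r K :
  0 <= r -> (forall i, 0 <= p i) -> (forall i, E (pt i)) -> \sum_i p i = 1 ->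
  coverable (orthoproj (subspace_of V) @` E) r K ->
  1 <= K%:R * \sum_i \sum_i' p i * p i' * \1_(small_proj hmn (pt i - pt i') r) V.
Proof.
move=> r0 p0 ptE p1 [U [EU Ur]].
have cP i : exists c : 'I_K, U c (orthoproj (subspace_of V) (pt i)).
  have [|c /= cK Uc] := EU (orthoproj (subspace_of V) (pt i)); first by exists (pt i).
  by exists (Ordinal cK).
have [c cU] := choice cP.
(* Each point is assigned to one covering set containing its projection; pairs assigned to the same
   set have projections at distance at most [r]. *)
pose P k := \sum_(i | c i == k) p i.
have P1 : \sum_k P k = 1 by rewrite -p1 (partition_big c xpredT).
have PP : \sum_k P k ^+ 2 <=
    \sum_i \sum_i' p i * p i' * \1_(small_proj hmn (pt i - pt i') r) V.
  rewrite (partition_big c xpredT) //=; apply: ler_sum => k _.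
  rewrite expr2 {1}/P mulr_suml; apply: ler_sum => i /eqP ik.
  rewrite mulr_sumr big_mkcond /=; apply: ler_sum => i' _; case: eqP => i'k; last first.
    by rewrite mulr_ge0 ?mulr_ge0 // indicE.
  rewrite indicE mem_set ?mulr1 // /small_proj /= orthoprojB.
  have /(Ur (c i) : _ -> _)/diam_leP := ltn_ord (c i).
  move=> /(_ r0); apply; first exact: cU.
  by rewrite ik -i'k; exact: cU.
have K0 : 0 < K%:R :> R.
  rewrite ltr0n lt0n; apply/eqP => K0; move: P1; rewrite big1 => [/eqP|[k kK] _].
    by rewrite eq_sym oner_eq0.
  by exfalso; move: kK; rewrite K0.
rewrite mulrC -ler_pdivrMr // mul1r; apply: le_trans PP.
(* Expanding this with [P1] yields the Cauchy-Schwarz bound. *)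
have : 0 <= \sum_k (P k - K%:R^-1) ^+ 2 by apply: sumr_ge0 => k _; rewrite sqr_ge0.
under eq_bigr do rewrite sqrrB.
rewrite big_split /= sumrB sumr_const card_ord sumrMnl -mulr_suml P1 mul1r.
have -> : K%:R^-1 ^+ 2 *+ K = K%:R^-1 :> R.
  by rewrite -[_ *+ K]mulr_natl expr2 mulrA divff ?mul1r // gt_eqF.
rewrite mulr2n; lra.
Qed.

End Energy.

(** * Borel-Cantelli over the dyadic scales *)

Section AlmostEvery.
Variables (R : realType) (n m : nat) (hmn : (m <= n)%N).
Variable gamma : probability (borel_grassmannian R hmn) R.
Hypothesis hgamma : rotation_invariant gamma.
Hypothesis n0 : (0 < n)%N.
Implicit Types (E : set 'rV[R]_n) (s t : R).

Lemma half_powR s : 2^-1 `^ s = (2 `^ s)^-1 :> R.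
Proof. by rewrite -powRN -powR_inv1 // -powRrM mulN1r. Qed.

Lemma two_powR_lt s t : s < t -> 2 `^ s < 2 `^ t :> R.
Proof.
move=> st; rewrite -ltr_ln ?posrE ?powR_gt0 // !ln_powR ltr_pM2r //.
by rewrite ln_gt0 // ltr1n.
Qed.

(** The mean energy is at most [C * beta ^+ k]. By Markov's inequality it exceeds [tau ^+ k] only
    with probability [C * (beta / tau) ^+ k], geometrically small as [t < s]; elsewhere
    [coverable_energy] bounds the covers from below. *)
Lemma small_exceptional_sets E s t : bounded_set E -> 0 < s -> s < m%:R -> t < s ->
  hausdorff_measure s E != 0%E ->
  exists (C rho : R), [/\ 0 < C, 0 < rho, rho < 1 &
    forall k, exists A : set (borel_grassmannian R hmn),
      [/\ measurable A, (gamma A <= (C * rho ^+ k)%:E)%E &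
        forall V : grassmannian R hmn, ~ A V -> forall K,
          coverable (orthoproj (subspace_of V) @` E) (2^-1 ^+ k) K ->
          1 <= K%:R * (2^-1 `^ t) ^+ k]].
Proof.
move=> Eb s0 sm ts Hs; have [b b0 frost] := discrete_frostman n0 Eb s0 Hs.
set beta := 2^-1 `^ s in frost; have beta0 : 0 < beta by rewrite powR_gt0 // invr_gt0.
set tau := 2^-1 `^ t; have tau0 : 0 < tau by rewrite powR_gt0 // invr_gt0.
have q1 : 1 < 2 ^+ m * beta.
  rewrite /beta half_powR ltr_pdivlMr ?powR_gt0 // mul1r -powR_mulrn //.
  exact: two_powR_lt.
have [C C0 energy] := energy_le hgamma n0 q1 beta0 (ltW b0).
exists C, (beta / tau); split => //; first by rewrite divr_gt0.
  rewrite ltr_pdivrMr // mul1r /beta /tau !half_powR ltf_pV2 ?posrE ?powR_gt0 //.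
  exact: two_powR_lt.
move=> k; have [N [p [pt [p0 ptE p1 pb]]]] := frost k.
have {}energy := energy k N p pt p0 p1 pb.
pose w (ij : 'I_N * 'I_N) := p ij.1 * p ij.2.
pose S (ij : 'I_N * 'I_N) := small_proj hmn (pt ij.1 - pt ij.2) (2^-1 ^+ k).
have w0 ij : 0 <= w ij by rewrite mulr_ge0.
have tk0 : 0 < tau ^+ k by rewrite exprn_gt0.
have [mA Ale] := weighted_events_markov gamma w0
  (fun ij => measurable_small_proj hmn _ _ : measurable (S ij)) tk0.
exists [set V | tau ^+ k <= \sum_ij w ij * \1_(S ij) V]; split => //.
  rewrite -[leLHS]fineK ?fin_num_measure // lee_fin expr_div_n mulrA.
  rewrite ler_pdivlMr // mulrC; apply: le_trans Ale _; apply: le_trans energy.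
  by rewrite pair_bigA.
move=> V /negP; rewrite -ltNge => fV K cK.
have h0 : 0 <= 2^-1 ^+ k :> R by rewrite exprn_ge0 // invr_ge0.
apply: le_trans (coverable_energy h0 p0 ptE p1 cK) _.
by rewrite ler_wpM2l // ltW // pair_bigA.
Qed.

(** The measures of the exceptional sets are summable, so their limit superior is a null set, and
    any other [V] avoids them from some level on. *)
Lemma ae_coverable E s t : bounded_set E -> 0 < s -> s < m%:R -> t < s ->
  hausdorff_measure s E != 0%E ->
  {ae gamma, forall V : grassmannian R hmn, exists k0, forall k, (k0 <= k)%N ->
    forall K, coverable (orthoproj (subspace_of V) @` E) (2^-1 ^+ k) K ->
      1 <= K%:R * (2^-1 `^ t) ^+ k}.
Proof.
move=> Eb s0 sm ts Hs.
have [C [rho [C0 r0 r1 /choice[A AP]]]] := small_exceptional_sets Eb s0 sm ts Hs.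
have mA k : measurable (A k) by case: (AP k).
exists (lim_sup_set A); split.
- by apply: bigcapT_measurable => i; exact: bigcup_measurable.
- apply: lim_sup_set_cvg0 => //.
  apply: (@le_lt_trans _ _ (C / (1 - rho))%:E); last exact: ltry.
  have r10 : 0 < 1 - rho by rewrite subr_gt0.
  apply: lime_le; first by apply: is_cvg_nneseries.
  apply: nearW => N; apply: (@le_trans _ _ (\sum_(0 <= k < N) (C * rho ^+ k)%:E)%E).
    by apply: lee_sum => k _; case: (AP k).
  rewrite sumEFin lee_fin -mulr_sumr ler_pM2l // big_mkord.
  rewrite -[leRHS]div1r ler_pdivlMr // mulrC.
  have -> : (1 - rho) * \sum_(i < N) rho ^+ i = 1 - rho ^+ N.
    by rewrite -opprB mulNr -subrX1 opprB.
  by rewrite gerBl exprn_ge0 // ltW.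
move=> V /= nV i _; apply: contrapT => H; apply: nV.
exists i => k ik K cK; have [_ _] := AP k; apply; last exact: cK.
by move=> Ak; apply: H; exists k.
Qed.

End AlmostEvery.

(** * Box and intermediate dimensions *)

Lemma limf_einf_le_esup (R : realType) (f : R -> \bar R) (F : set_system R) :
  ProperFilter F -> (limf_einf f F <= limf_esup f F)%E.
Proof.
move=> FF; rewrite limf_einfE limf_esupE.
apply: ge_ereal_sup => _ [A FA <-]; apply: le_ereal_inf_tmp => _ [B FB <-].
have [x [Ax Bx]] := filter_ex (filterI FA FB).
apply: (@le_trans _ _ (f x)); first by apply: ereal_inf_lbound; exists x.
by apply: ereal_sup_ubound; exists x.
Qed.

Section BoxDimensions.
Variables (R : realType) (n : nat).
Implicit Types (E F : set 'rV[R]_n) (V : {vspace 'rV[R]_n}) (r u : R).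

Definition box_quotient F r : \bar R :=
  (lne (covering_number F r) * ((- ln r)^-1)%:E)%E.

(** Nonemptiness keeps the covering number at least 1 and a finite cover keeps it finite, so the
    extended logarithm and product become real ones. *)
Lemma box_quotientE F r k : F !=set0 -> coverable F r k -> exists c : R,
  [/\ 1 <= c, covering_number F r = c%:E & box_quotient F r = (ln c / - ln r)%:E].
Proof.
move=> [x Fx] Fk.
have c1 : (1%:E <= covering_number F r)%E.
  apply: covering_number_ge => -[|l [U [FU _]]]; last by rewrite lee_fin ler1n.
  by move=> [U [FU _]]; have [] := FU x Fx.
have := covering_number_le Fk; rewrite /box_quotient.
case: (covering_number F r) c1 => [c| |] //; rewrite lee_fin => c1 _.
by exists c; split=> //; rewrite lne_EFin ?(lt_le_trans ltr01) // EFinM.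
Qed.

Lemma neg_ln_gt0 r : 0 < r -> r < 1 -> 0 < - ln r.
Proof. by move=> r0 r1; rewrite oppr_gt0 ln_lt0 // r0. Qed.

Lemma box_quotient_le F r k u : F !=set0 -> coverable F r k -> 0 < r -> r < 1 ->
  k%:R <= r `^ (- u) -> (box_quotient F r <= u%:E)%E.
Proof.
move=> F0 Fk r0 r1 ku; have [c [c1 cE ->]] := box_quotientE F0 Fk.
have ck : c <= k%:R by rewrite -lee_fin -cE; exact: covering_number_le.
rewrite lee_fin ler_pdivrMr ?neg_ln_gt0 // mulrN -mulNr -ln_powR ler_ln ?posrE ?powR_gt0 //.
  exact: le_trans ku.
exact: lt_le_trans c1.
Qed.

Lemma box_quotient_ge F r k u : F !=set0 -> coverable F r k -> 0 < r -> r < 1 ->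
  (forall l, coverable F r l -> r `^ (- u) <= l%:R) -> (u%:E <= box_quotient F r)%E.
Proof.
move=> F0 Fk r0 r1 Fu; have [c [c1 cE ->]] := box_quotientE F0 Fk.
have uc : r `^ (- u) <= c.
  by rewrite -lee_fin -cE; apply: covering_number_ge => l /Fu; rewrite lee_fin.
rewrite lee_fin ler_pdivlMr ?neg_ln_gt0 // mulrN -mulNr -ln_powR ler_ln ?posrE ?powR_gt0 //.
exact: lt_le_trans c1.
Qed.

Lemma lower_box_dim_ge F u rho : 0 < rho ->
  (forall r, 0 < r -> r < rho -> (u%:E <= box_quotient F r)%E) ->
  (u%:E <= lower_box_dim F)%E.
Proof.
move=> rho0 H; rewrite /lower_box_dim limf_einfE.
apply: (@le_trans _ _ (ereal_inf (box_quotient F @` [set r | 0 < r < rho]))).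
  by apply: le_ereal_inf_tmp => _ [r /= /andP[r0 rr] <-]; exact: H.
apply: ereal_sup_ubound; exists [set r | 0 < r < rho] => //.
by near=> r; apply/andP; split; near: r; [exact: nbhs_right_gt|exact: nbhs_right_lt].
Unshelve. all: by end_near. Qed.

Lemma upper_box_dim_le F u rho : 0 < rho ->
  (forall r, 0 < r -> r < rho -> (box_quotient F r <= u%:E)%E) ->
  (upper_box_dim F <= u%:E)%E.
Proof.
move=> rho0 H; rewrite /upper_box_dim limf_esupE.
apply: (@le_trans _ _ (ereal_sup (box_quotient F @` [set r | 0 < r < rho]))).
  apply: ereal_inf_lbound; exists [set r | 0 < r < rho] => //.
  by near=> r; apply/andP; split; near: r; [exact: nbhs_right_gt|exact: nbhs_right_lt].
by apply: ge_ereal_sup => _ [r /= /andP[r0 rr] <-]; exact: H.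
Unshelve. all: by end_near. Qed.

Lemma lower_box_dim_le F u :
  (forall rho, 0 < rho -> exists r, [/\ 0 < r, r < rho & (box_quotient F r <= u%:E)%E]) ->
  (lower_box_dim F <= u%:E)%E.
Proof.
move=> H; rewrite /lower_box_dim limf_einfE.
apply: ge_ereal_sup => _ [A [e /= e0 eA] <-].
have [r [r0 re ru]] := H e e0; apply: le_trans ru.
apply: ereal_inf_lbound; exists r => //; apply: eA => //=.
by rewrite sub0r normrN gtr0_norm.
Qed.

Lemma lower_le_upper_box_dim F : (lower_box_dim F <= upper_box_dim F)%E.
Proof. exact: limf_einf_le_esup. Qed.

Lemma bounded_diam E : bounded_set E -> exists2 d : R, 0 < d &
  forall x y, E x -> E y -> enorm (x - y) <= d.
Proof.
move=> /bounded_coord[B B0 EB]; exists (n.+1%:R * (2 * B)).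
  by rewrite !mulr_gt0.
move=> x y Ex Ey; rewrite enorm_le; last by rewrite !mulr_ge0 // ltW.
apply: (@le_trans _ _ (\sum_(i < n) (2 * B) ^+ 2)).
  apply: ler_sum => i _; rewrite -expr2 !mxE -real_normK ?num_real //.
  rewrite lerXn2r ?nnegrE ?mulr_ge0 ?(ltW B0) //.
  apply: le_trans (ler_normB _ _) _; rewrite mulrDl mul1r lerD // EB //.
rewrite sumr_const card_ord [leRHS]exprMn -[_ *+ n]mulr_natl ler_wpM2r ?sqr_ge0 //.
rewrite -natrX ler_nat expnS expn1; lia.
Qed.

(** * Dimension estimates for one projection *)

Section Projected.
Variables (V : {vspace 'rV[R]_n}) (E : set 'rV[R]_n).
Hypotheses (n0 : (0 < n)%N) (E0 : E !=set0).

Let F := orthoproj V @` E.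

Let F0 : F !=set0.
Proof. by have [x Ex] := E0; exists (orthoproj V x); exists x. Qed.

Lemma proj_coverable U (d delta : R) : 0 < delta -> delta <= d ->
  (forall x y, U x -> U y -> enorm (x - y) <= d) ->
  exists2 k, coverable (orthoproj V @` U) delta k &
    k%:R <= (3 * n%:R * (d / delta)) ^+ \dim V.
Proof.
move=> d0 dd Ud; apply: subspace_coverable => //.
  by move=> _ [x _ <-]; have [] := orthoprojP V x.
move=> _ _ [x Ux <-] [y Uy <-]; rewrite -orthoprojB.
by apply: le_trans (enorm_orthoproj_le V _) _; exact: Ud.
Qed.

Lemma upper_box_dim_proj_le : bounded_set E ->
  (upper_box_dim F <= (\dim V)%:R%:E)%E.
Proof.
move=> /bounded_diam[d d0 Ed]; set m := \dim V.
apply/lee_addgt0Pr => e e0; rewrite -EFinD.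
have n0' : 0 < n%:R :> R by rewrite ltr0n.
pose a := (3 * n%:R * d) ^+ m; have a0 : 0 < a by rewrite exprn_gt0 // !mulr_gt0.
(* Below [a]^ (- e^-1)[the constant]a[is at most]r [^ (- e)], so it only costs [e] in the
   exponent. *)
pose rho := Num.min d (Num.min 1 (a `^ (- e^-1))).
have rho0 : 0 < rho by rewrite !lt_min d0 ltr01 powR_gt0.
apply: (upper_box_dim_le rho0) => r r0; rewrite !lt_min => /and3P[rd r1 ra].
have [k Fk ke] := proj_coverable r0 (ltW rd) Ed.
apply: (box_quotient_le F0 Fk r0 r1); apply: le_trans ke _.
rewrite -/m mulrA expr_div_n -/a opprD powRD; last by rewrite (gt_eqF r0) implybT.
rewrite powRN powR_mulrn ?(ltW r0) // mulrC ler_pM2l ?invr_gt0 ?exprn_gt0 //.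
have -> : a = (a `^ (- e^-1)) `^ (- e).
  by rewrite -powRrM mulrNN mulVf ?gt_eqF // powRr1 // ltW.
rewrite ![_ `^ (- e)]powRN lef_pV2 ?posrE ?powR_gt0 //.
by apply: ge0_ler_powR; rewrite ?nnegrE ?powR_ge0 // ltW.
Qed.

(** Passage from dyadic scales to all [r]: with [2^-(j+1) <= r < 2^-j], a cover at scale [r] is one
    at scale [2^-j], and the gap [t - u] pays for the lost level. *)
Lemma lower_box_dim_proj_ge t u : bounded_set E -> 0 <= u -> u < t ->
  (exists k0, forall k, (k0 <= k)%N -> forall K, coverable F (2^-1 ^+ k) K ->
     1 <= K%:R * (2^-1 `^ t) ^+ k) -> (u%:E <= lower_box_dim F)%E.
Proof.
move=> /bounded_diam[d d0 Ed] u0 ut [k0 H].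
have tu0 : 0 < t - u by rewrite subr_gt0.
(* For [j >= u / (t - u)] one has [u * (j + 1) <= t * j]. *)
pose k1 := (k0 + (Num.truncn (u / (t - u))).+1)%N.
pose rho := Num.min d (2^-1 ^+ k1); have h0 k : 0 < 2^-1 ^+ k :> R by rewrite exprn_gt0 // invr_gt0.
have rho0 : 0 < rho by rewrite lt_min d0 h0.
apply: (lower_box_dim_ge rho0) => r r0; rewrite lt_min => /andP[rd rk1].
have h1 k : 2^-1 ^+ k <= 1 :> R by rewrite exprn_ile1 ?invr_ge0 // invf_le1 // ler1n.
have r1 : r < 1 by exact: lt_le_trans rk1 (h1 _).
have [k Fk _] := proj_coverable r0 (ltW rd) Ed.
apply: (box_quotient_ge F0 Fk r0 r1) => l Fl.
have [j0 rj0] : exists j, 2^-1 ^+ j <= r.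
  exists (Num.truncn r^-1).+1; rewrite exprVn -[leRHS]invrK lef_pV2 ?posrE ?invr_gt0 ?exprn_gt0 //.
  have /andP[_ /ltW /le_trans] : (Num.truncn r^-1)%:R <= r^-1 < (Num.truncn r^-1).+1%:R.
    by rewrite truncn_itv // invr_ge0 ltW.
  by apply; rewrite -natrX ler_nat ltnW // ltn_expl.
have [j _ [jr rj]] := dyadic_scale rj0 r1.
have k1j : (k1 <= j)%N.
  rewrite leqNgt; apply/negP => jk1; move: rk1; rewrite ltNge => /negP; apply.
  apply: le_trans jr; apply: ler_wiXn2l => //.
  by rewrite invf_le1 // ler1n.
have Hj := H j (leq_trans (leq_addr _ _) k1j) l (coverable_le (ltW rj) Fl).
rewrite powRN -[leLHS]div1r ler_pdivrMr ?powR_gt0 //; apply: le_trans Hj _.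
rewrite ler_wpM2l //; apply: (@le_trans _ _ ((2^-1 ^+ j.+1) `^ u)); last first.
  by apply: ge0_ler_powR => //; rewrite nnegrE ltW.
have q0 : 0 <= 2^-1 :> R by rewrite invr_ge0.
rewrite -(powR_mulrn _ (powR_ge0 _ _)) -powRrM -(powR_mulrn j.+1 q0) -powRrM.
apply: ger_powR; first by rewrite invr_gt0 ltr0n invf_le1 ?ltr0n // ler1n.
have uj : u / (t - u) <= j%:R.
  have ut0 : 0 <= u / (t - u) by rewrite divr_ge0 // ltW.
  have /andP[_ /ltW /le_trans] := truncn_itv ut0; apply; rewrite ler_nat.
  by apply: leq_trans k1j; rewrite leq_addl.
move: uj; rewrite ler_pdivrMr // -natr1; lra.
Qed.

(** The piece [U i] contributes [(3 n d_i / delta)^m], where [d_i^m <= d_i^s r^(m - s)]. The bound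
    on the sum cancels [(3 n)^m], and [r = delta^theta] gives the exponent. *)
Lemma intermediate_cover_proj (theta r s : R) (D : set nat) (U : nat -> set 'rV[R]_n) :
  0 < theta -> 0 <= s -> s < (\dim V)%:R -> 0 < r -> r < 1 ->
  intermediate_cover E theta r D U ->
  (\esum_(i in D) diam (U i) `^ s <= (((3 * n%:R) ^+ \dim V)^-1)%:E)%E ->
  let delta := r `^ theta^-1 in
  (box_quotient F delta <= ((\dim V)%:R - theta * ((\dim V)%:R - s))%:E)%E.
Proof.
set m := \dim V; set c := (_ ^+ m)^-1.
move=> th0 s0 sm r0 r1 [EU Ud] sumU; set delta := r `^ theta^-1; cbv zeta.
have n0' : 0 < n%:R :> R by rewrite ltr0n.
have dl0 : 0 < delta by rewrite powR_gt0.
have dl1 : delta < 1.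
  have -> : 1 = 1 `^ theta^-1 :> R by rewrite powR1.
  by apply: gt0_ltr_powR; rewrite ?nnegrE ?invr_gt0 // ltW.
pose d i := fine (diam (U i)).
have dE i : D i -> [/\ diam (U i) = (d i)%:E, delta <= d i & d i <= r].
  move=> Di; have [/(_ th0) + +] := Ud i Di; rewrite /d.
  by case: (diam (U i)) => [x| |] //=; rewrite !lee_fin.
have finD : finite_set D.
  apply: contrapT => infD.
  have ds0 : 0 < delta `^ s by rewrite powR_gt0.
  have c0 : 0 <= c by rewrite invr_ge0 exprn_ge0 // mulr_ge0.
  have [B BD cB] := infinite_set_fset (Num.truncn (c / delta `^ s)).+1 infD.
  pose l := finmap.enum_fset B; have ul : uniq l := finmap.fset_uniq B.
  have lD i : i \in l -> D i by exact: BD.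
  have suml : (\sum_(i <- l) diam (U i) `^ s <= c%:E)%E.
    rewrite fsbig_seq //; apply: le_trans sumU; apply: ereal_sup_ubound.
    by exists [set` l] => //; split => //; exact: finite_seq.
  have : (((size l)%:R * delta `^ s)%:E <= c%:E)%E.
    apply: le_trans suml; apply: (@le_trans _ _ (\sum_(i <- l) (delta `^ s)%:E)%E).
      by rewrite sumEFin lee_fin big_const_seq count_predT iter_addr addr0 mulr_natl.
    rewrite big_seq [leRHS]big_seq; apply: lee_sum => i il.
    have [-> di _] := dE i (lD i il); rewrite poweR_EFin lee_fin.
    by apply: ge0_ler_powR; rewrite ?nnegrE ?(le_trans _ di) // ltW.
  rewrite lee_fin -ler_pdivlMr // leNgt => /negP; apply.
  have cd0 : 0 <= c / delta `^ s by rewrite divr_ge0 // ltW.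
  have /andP[_ /lt_le_trans] := truncn_itv cd0; apply.
  by rewrite ler_nat.
have /finite_seqP[sq0 DE0] := finD; pose sq := undup sq0.
have DE : D = [set` sq] by rewrite DE0; apply/seteqP; split => i /=; rewrite mem_undup.
have sumd : \sum_(i <- sq) d i `^ s <= c.
  rewrite -lee_fin -sumEFin; apply: le_trans sumU.
  rewrite esum_fset //; last by move=> i _; exact: poweR_ge0.
  rewrite DE -fsbig_seq ?undup_uniq // big_seq [leRHS]big_seq.
  apply: lee_sum => i iq; have [|-> _ _] := dE i; first by rewrite DE.
  by rewrite poweR_EFin.
have /choice[k kP] i : exists k, D i -> coverable (orthoproj V @` U i) delta k /\
    k%:R <= (3 * n%:R * (d i / delta)) ^+ m.
  have [Di|nDi] := pselect (D i); last by exists 0%N.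
  have [Ui di ir] := dE i Di.
  have [x y Ux Uy|k ck kle] := @proj_coverable (U i) (d i) delta dl0 di; last by exists k.
  have di0 : 0 <= d i by exact: le_trans (ltW dl0) di.
  by apply: (diam_leP (U i) di0).1 => //; rewrite Ui.
have Fk : coverable F delta (\sum_(i <- sq) k i)%N.
  apply: coverableS (coverable_bigcup (A := fun i => orthoproj V @` U i) _).
    move=> _ [x /EU[i Di Uix] <-]; exists i; first by rewrite -DE.
    by exists x.
  by move=> i iq; have [] := kP i; rewrite ?DE.
apply: (box_quotient_le F0 Fk dl0 dl1).
have rd : delta `^ theta = r by rewrite -powRrM mulVf ?gt_eqF // powRr1 // ltW.
rewrite opprB powRD; last by rewrite (gt_eqF dl0) implybT.
rewrite powRrM rd powRN powR_mulrn ?(ltW dl0) //.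
rewrite natr_sum; apply: (@le_trans _ _ (\sum_(i <- sq) c^-1 * r `^ (m%:R - s) / delta ^+ m * d i `^ s)).
  rewrite big_seq [leRHS]big_seq; apply: ler_sum => i iq.
  have Di : D i by rewrite DE.
  have [_ di ir] := dE i Di; have di0 : 0 < d i by exact: lt_le_trans di.
  apply: le_trans (kP i Di).2 _.
  have dm : d i ^+ m = d i `^ s * d i `^ (m%:R - s).
    rewrite -powR_mulrn ?(ltW di0) // -powRD; last by rewrite (gt_eqF di0) implybT.
    by rewrite addrC subrK.
  have -> : (3 * n%:R * (d i / delta)) ^+ m =
      c^-1 / delta ^+ m * d i `^ s * d i `^ (m%:R - s).
    by rewrite exprMn expr_div_n dm /c invrK; ring.
  have -> : c^-1 * r `^ (m%:R - s) / delta ^+ m * d i `^ s =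
    c^-1 / delta ^+ m * d i `^ s * r `^ (m%:R - s) by ring.
  rewrite ler_wpM2l //.
    by rewrite !mulr_ge0 ?powR_ge0 // !invr_ge0 ?exprn_ge0 ?invr_ge0 ?exprn_ge0 ?mulr_ge0 // ltW.
  by apply: ge0_ler_powR; rewrite ?nnegrE ?subr_ge0 // ltW.
have c0 : 0 < c by rewrite invr_gt0 exprn_gt0 // mulr_gt0.
have dm0 : 0 < delta ^+ m by rewrite exprn_gt0.
have -> : r `^ (m%:R - s) / delta ^+ m = c^-1 * r `^ (m%:R - s) / delta ^+ m * c.
  by rewrite -!mulrA [RHS]mulrC -!mulrA mulfV ?mulr1 // gt_eqF.
rewrite -mulr_sumr ler_wpM2l //.
by rewrite divr_ge0 ?mulr_ge0 ?powR_ge0 ?invr_ge0 ?(ltW c0) ?(ltW dm0).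
Qed.

Section Limit.
Variable theta : R.
Hypotheses (th0 : 0 < theta) (th1 : theta <= 1).

Let drop s : R := (\dim V)%:R - theta * ((\dim V)%:R - s).

Let drop_lt s : s < (\dim V)%:R -> drop s < (\dim V)%:R.
Proof. by move=> sm; rewrite /drop ltrBlDr ltrDl mulr_gt0 // subr_gt0. Qed.

Let eps : R := ((3 * n%:R) ^+ \dim V)^-1.

Let eps0 : 0 < eps.
Proof. by rewrite invr_gt0 exprn_gt0 // mulr_gt0 // ltr0n. Qed.

Lemma lower_intermediate_dim_ge : lower_box_dim F = (\dim V)%:R%:E ->
  ((\dim V)%:R%:E <= lower_intermediate_dim E theta)%E.
Proof.
move=> Fm; apply: le_ereal_inf_tmp => _ [s [s0 Hs] <-].
rewrite lee_fin leNgt; apply/negP => sm.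
suff : (lower_box_dim F <= (drop s)%:E)%E by rewrite Fm lee_fin leNgt drop_lt.
apply: lower_box_dim_le => rho rho0.
have r00 : 0 < Num.min (rho / 2) (1 / 2) by rewrite lt_min !divr_gt0.
have [r [[r0 rr0] [D [U [EU sumU]]]]] := Hs _ _ eps0 r00.
have [rrho r1] : r < rho /\ r < 1.
  move: rr0; rewrite le_min => /andP[? ?]; split; lra.
exists (r `^ theta^-1); split; first by rewrite powR_gt0.
  apply: le_lt_trans rrho; rewrite -[leRHS]powRr1 ?(ltW r0) //.
  by apply: ger_powR; rewrite ?r0 ?(ltW r1) // invf_ge1.
exact: (intermediate_cover_proj th0 s0 sm r0 r1 EU sumU).
Qed.

Lemma upper_intermediate_dim_ge : upper_box_dim F = (\dim V)%:R%:E ->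
  ((\dim V)%:R%:E <= upper_intermediate_dim E theta)%E.
Proof.
move=> Fm; apply: le_ereal_inf_tmp => _ [s [s0 Hs] <-].
rewrite lee_fin leNgt; apply/negP => sm.
suff : (upper_box_dim F <= (drop s)%:E)%E by rewrite Fm lee_fin leNgt drop_lt.
have [r0 [r00 {}Hs]] := Hs _ eps0.
have m0 : 0 < Num.min r0 (1 / 2) by rewrite lt_min r00 divr_gt0.
apply: (@upper_box_dim_le _ _ (Num.min r0 (1 / 2) `^ theta^-1)).
  by rewrite powR_gt0.
move=> delta d0 dlt; set r := delta `^ theta.
have rlt : r < Num.min r0 (1 / 2).
  have -> : Num.min r0 (1 / 2) = (Num.min r0 (1 / 2) `^ theta^-1) `^ theta.
    by rewrite -powRrM mulVf ?gt_eqF // powRr1 // ltW.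
  by apply: gt0_ltr_powR; rewrite ?nnegrE ?powR_ge0 // ltW.
move: rlt; rewrite lt_min => /andP[rr0 r12].
have rp : 0 < r by rewrite powR_gt0.
have [D [U [EU sumU]]] := Hs r rp (ltW rr0).
have -> : delta = r `^ theta^-1.
  by rewrite /r -powRrM mulfV ?gt_eqF // powRr1 // ltW.
apply: (intermediate_cover_proj th0 s0 sm rp _ EU sumU); lra.
Qed.

End Limit.

End Projected.
End BoxDimensions.

(** * Continuity at 0 and assembly of the two equivalences *)

Section Main.
Variables (R : realType) (n m : nat) (hmn : (m <= n)%N).
Variable gamma : probability (borel_grassmannian R hmn) R.
Implicit Types (E : set 'rV[R]_n) (V : grassmannian R hmn).

Lemma dim_subspace_of V : \dim (subspace_of V) = m.
Proof. exact/eqP/(valP V). Qed.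

Lemma cvg_within01_ge (g : R -> \bar R) (l c : \bar R) :
  g theta @[theta --> within `[0, 1] (nbhs (0 : R))] --> l ->
  (forall theta, 0 < theta -> theta <= 1 -> (c <= g theta)%E) -> (c <= l)%E.
Proof.
move=> gl cg; rewrite leNgt; apply/negP => lc.
have /gl [e /= e0 He] : nbhs l [set y | (y < c)%E].
  by apply: open_nbhs_nbhs; split => //; exact: open_ereal_lt_ereal.
(* A positive parameter in the neighbourhood, since [cg] says nothing at 0 itself. *)
have t0 : 0 < Num.min (e / 2) 1 by rewrite lt_min ltr01 andbT divr_gt0.
have t1 : Num.min (e / 2) 1 <= 1 by rewrite ge_min lexx orbT.
have := He (Num.min (e / 2) 1); rewrite /= sub0r normrN gtr0_norm //.
rewrite gt_min ltr_pdivrMr // ltr_pMr // ltr1n => /(_ isT).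
by rewrite in_itv /= (ltW t0) t1 => /(_ isT); rewrite ltNge cg.
Qed.

Lemma hausdorff_null_cover E (s eps r : R) : 0 < eps -> 0 < r ->
  hausdorff_measure s E = 0%E ->
  exists (D : set nat) (U : nat -> set 'rV[R]_n),
    intermediate_cover E 0 r D U /\ (\esum_(i in D) diam (U i) `^ s <= eps%:E)%E.
Proof.
move=> eps0 r0 E0; have : (hausdorff_content s r E < eps%:E)%E.
  apply: (@le_lt_trans _ _ 0%E); last by rewrite lte_fin.
  by rewrite -E0; apply: ereal_sup_ubound; exists r => //=; rewrite ?E0.
move=> /ereal_inf_lt[_ [D [U [EU Ur ->]]] Ueps]; exists D, U; split; last exact: ltW.
by split => // i Di; split; [rewrite ltxx|exact: Ur].
Qed.

Lemma lower_intermediate_dim0_le E : (lower_intermediate_dim E 0 <= hausdorff_dim E)%E.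
Proof.
apply: ereal_inf_le_tmp => _ [s [s0 sE] <-]; exists s => //; split => // eps r0 eps0 r00.
by exists r0; split; [split|exact: hausdorff_null_cover].
Qed.

Lemma upper_intermediate_dim0_le E : (upper_intermediate_dim E 0 <= hausdorff_dim E)%E.
Proof.
apply: ereal_inf_le_tmp => _ [s [s0 sE] <-]; exists s => //; split => // eps eps0.
by exists 1; split => // r r0 _; exact: hausdorff_null_cover.
Qed.

(** A null set is not the whole Grassmannian, as [gamma] has mass 1. The converse direction works
    with the single [V] obtained here. *)
Lemma ae_exists (P : grassmannian R hmn -> Prop) :
  {ae gamma, forall V : grassmannian R hmn, P V} -> exists V, P V.
Proof.
move=> [A [mA A0 PA]]; apply: contrapT => nP.
have AT : A = setT.
  by apply/seteqP; split => // V _; apply: PA => /= PV; apply: nP; exists V.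
by move/eqP: A0; rewrite AT probability_setT onee_eq0.
Qed.

Lemma ae_lower_box_dim_ge E : rotation_invariant gamma -> (0 < n)%N -> (0 < m)%N ->
  E !=set0 -> bounded_set E -> (m%:R%:E <= hausdorff_dim E)%E ->
  {ae gamma, forall V : grassmannian R hmn,
     (m%:R%:E <= lower_box_dim (orthoproj (subspace_of V) @` E))%E}.
Proof.
move=> hgamma n0 m0 E0 Eb mE.
have m1 : 1 <= m%:R :> R by rewrite ler1n.
(* Exponents [t l < s l < m] increasing to [m]: countably many, so that the null sets can be united.
   The shift by 2 ensures [s l > 0], as [m >= 1]. *)
pose s (l : nat) : R := m%:R - l.+2%:R^-1; pose t (l : nat) : R := m%:R - 2 / l.+2%:R.
have l0 l : 0 < l.+2%:R^-1 :> R by rewrite invr_gt0.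
have sm l : s l < m%:R by rewrite ltrBlDr ltrDl.
have s0 l : 0 < s l.
  by rewrite subr_gt0; apply: lt_le_trans m1; rewrite invf_lt1 // ltr1n.
have ts l : t l < s l by rewrite ltrD2l ltrN2 -[ltLHS]mul1r ltr_pM2r // ltr1n.
have Hs l : hausdorff_measure (s l) E != 0%E.
  apply/eqP => H; have : (hausdorff_dim E <= (s l)%:E)%E.
    by apply: ereal_inf_lbound; exists (s l) => //; split => //; exact: ltW.
  by move/(le_trans mE); rewrite lee_fin leNgt sm.
have : {ae gamma, forall V : grassmannian R hmn, forall l, exists k0, forall k,
    (k0 <= k)%N -> forall K,
    coverable (orthoproj (subspace_of V) @` E) (2^-1 ^+ k) K ->
    1 <= K%:R * (2^-1 `^ (t l)) ^+ k}.
  apply: ae_foralln => l.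
  exact: (ae_coverable hgamma n0 Eb (s0 l) (sm l) (ts l) (Hs l)).
move=> [A [mA A0 AP]]; exists A; split => // V nV; apply: AP => HV; apply: nV.
apply/lee_subgt0Pr => e e0.
pose e' := Num.min e 1; have e'0 : 0 < e' by rewrite lt_min e0 ltr01.
have e'e : e' <= e by rewrite ge_min lexx.
have e'1 : e' <= 1 by rewrite ge_min lexx orbT.
(* This gives [m - e' < t l], while [e' <= 1] keeps [m - e'] nonnegative. *)
pose l := Num.truncn (2 / e').
apply: (@le_trans _ _ (m%:R - e')%:E); first by rewrite -EFinB lee_fin lerB.
apply: (lower_box_dim_proj_ge n0 E0 Eb _ _ (HV l)).
  by rewrite subr_ge0 (le_trans e'1).
rewrite /t ltrD2l ltrN2 ltr_pdivrMr // mulrC -ltr_pdivrMr //.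
have d0 : 0 <= 2 / e' by rewrite divr_ge0 // ltW.
have /andP[_ /lt_le_trans] := truncn_itv d0; apply; by rewrite ler_nat.
Qed.

End Main.

Unset Implicit Arguments.

Theorem corollary6p4 (R : realType) (n m : nat) (hn : (1 <= n)%N)
    (hm : (1 <= m)%N) (hmn : (m <= n)%N)
    (gamma : probability (borel_grassmannian R hmn) R)
    (hgamma : rotation_invariant gamma)
    (E : set 'rV[R]_n) (hE0 : E !=set0) (hEb : bounded_set E) :
  (lower_intermediate_dim E theta @[theta --> within `[0, 1] (nbhs (0 : R))]
     --> lower_intermediate_dim E 0 ->
   ({ae gamma, forall V : grassmannian R hmn,
       lower_box_dim (orthoproj (subspace_of V) @` E) = m%:R%:E} <->
    (m%:R%:E <= hausdorff_dim E)%E)) /\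
  (upper_intermediate_dim E theta @[theta --> within `[0, 1] (nbhs (0 : R))]
     --> upper_intermediate_dim E 0 ->
   ({ae gamma, forall V : grassmannian R hmn,
       upper_box_dim (orthoproj (subspace_of V) @` E) = m%:R%:E} <->
    (m%:R%:E <= hausdorff_dim E)%E)).
Proof.
have ub (V : grassmannian R hmn) : (upper_box_dim (orthoproj (subspace_of V) @` E) <= m%:R%:E)%E.
  by have := upper_box_dim_proj_le (subspace_of V) hn hE0 hEb; rewrite dim_subspace_of.
have lub (V : grassmannian R hmn) := lower_le_upper_box_dim (orthoproj (subspace_of V) @` E).
have lb : (m%:R%:E <= hausdorff_dim E)%E -> {ae gamma, forall V : grassmannian R hmn,
    (m%:R%:E <= lower_box_dim (orthoproj (subspace_of V) @` E))%E}.
  exact: ae_lower_box_dim_ge.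
split=> cont; split.
- move=> /ae_exists[V Vm]; apply: le_trans (lower_intermediate_dim0_le E).
  apply: cvg_within01_ge cont _ => theta th0 th1.
  by rewrite -(dim_subspace_of V); apply: lower_intermediate_dim_ge; rewrite ?dim_subspace_of.
(* A projection never has upper box dimension above [m], so the almost sure lower bound is an
   equality. *)
- move=> /lb[A [mA A0 AP]]; exists A; split => // V nV; apply: AP => Vm; apply: nV.
  by apply/eqP; rewrite eq_le Vm (le_trans (lub V)).
- move=> /ae_exists[V Vm]; apply: le_trans (upper_intermediate_dim0_le E).
  apply: cvg_within01_ge cont _ => theta th0 th1.
  by rewrite -(dim_subspace_of V); apply: upper_intermediate_dim_ge; rewrite ?dim_subspace_of.
- move=> /lb[A [mA A0 AP]]; exists A; split => // V nV; apply: AP => Vm; apply: nV.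
  by apply/eqP; rewrite eq_le ub (le_trans Vm).
Qed.
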